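(* Suppose that $f(x,y)$ is concave and $g(x,y)$ is convex in the variable $y$ for all $x\in X$, and that $f,g$ are twice continuously differentiable. Let $\bar x\in\mathrm{bdy}\,X$ be a local solution of $\min_{x\in X}V(x)$. Consider the constraint system in $(x,y,\lambda)$ $$(\ast)\qquad\nabla_y\mathcal L(x,y,\lambda)=0,\quad\lambda\ge0.$$ Suppose that the restricted sup-compactness holds at $\bar x$ and that one of the following conditions holds: (a) MFCQ holds at all $y\in\mathcal S(\bar x)$ (for the system $g(\bar x,\cdot)\le0$), and a stable CQ holds for $(\ast)$ at all $(\bar x,\tilde y,\tilde\lambda)$ with $\tilde y\in\mathcal S(\bar x)$, $\tilde\lambda\in\Sigma(\bar x,\tilde y)$; (b) Robinson stability (RS) holds at some $y\in\mathcal S(\bar x)$, a stable parametric CQ holds at all $y\in\mathcal S(\bar x)$ (for $g(x,y)\le0$ in the variable $y$ with parameter $x$ at $\bar x$), a stable CQ holds for $(\ast)$ at all $(\bar x,\tilde y,\tilde\lambda)$ with $\tilde y\in\mathcal S(\bar x)$, $\tilde\lambda\in\Sigma(\bar x,\tilde y)$, and $$\bigcup_{y\in\mathcal S(\bar x),\,\lambda\in\Sigma(\bar x,y)}\{\nabla_{xy}^2\mathcal L(\bar x,y,\lambda)u:\ \nabla_{yy}^2\mathcal L(\bar x,y,\lambda)u=0,\ 0\le-\nabla_yg(\bar x,y)^\top u\perp\lambda\ge0\}=\{0\}.$$ Then there exist $\bar y\in\mathcal S(\bar x)$, $\bar\lambda\in\Sigma(\bar x,\bar y)$ and a multiplier $\bar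 u$ such that $$0\in\nabla_x\mathcal L(\bar x,\bar y,\bar\lambda)+\nabla_{xy}^2\mathcal L(\bar x,\bar y,\bar\lambda)\bar u+\mathcal N_X(\bar x),$$ $$\nabla_y\mathcal L(\bar x,\bar y,\bar\lambda)=0,\qquad\nabla_{yy}^2\mathcal L(\bar x,\bar y,\bar\lambda)\bar u=0,$$ $$0\le-\nabla_yg(\bar x,\bar y)^\top\bar u-g(\bar x,\bar y)\perp\bar\lambda\ge0,\qquad0\le-g(\bar x,\bar y)\perp\bar\lambda\ge0.$$
   Context: Setting. $f:\mathbb R^{n+m}\to\mathbb R$, $g:\mathbb R^{n+m}\to\mathbb R^q$, and $X\subseteq\mathbb R^n$ is closed. For $x\in\mathbb R^n$ let $\mathcal F(x)=\{y\in\mathbb R^m:g(x,y)\le0\}$, $V(x)=\sup\{f(x,y):y\in\mathcal F(x)\}$ ($=-\infty$ if $\mathcal F(x)=\emptyset$), $\mathcal S(x)=\{y\in\mathcal F(x):f(x,y)=V(x)\}$. For a vector-valued map, $\nabla$ is the transposed Jacobian. $\mathcal L(x,y,\lambda)=f(x,y)-g(x,y)^\top\lambda$; $\nabla^2_{xy}\mathcal L\in\mathbb R^{n\times m}$, with $\nabla_{xy}^2\mathcal L\,u=\nabla_x(u^\top\nabla_y\mathcal L)$. $\Sigma(x,y)=\{\lambda:\nabla_y\mathcal L(x,y,\lambda)=0,\ 0\le-g(x,y)\perp\lambda\ge0\}$. $\mathcal N_X(\bar x)$ is the limiting normal cone: limits of $\xi^k\in\widehat{\mathcal N}_X(x^k)$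 with $x^k\to\bar x$, $x^k\in X$, where $\widehat{\mathcal N}_X(x^* )=\{\xi:\xi^\top(x-x^* )\le o(\|x-x^*\|)\ \forall x\in X\}$. Restricted sup-compactness at $\bar x$: $V(\bar x)$ is finite and there are $\epsilon,\delta>0$ and a compact set $\Omega$ such that $\mathcal S(x)\cap\Omega\ne\emptyset$ for all $x$ with $\|x-\bar x\|<\delta$ and $V(x)>V(\bar x)-\epsilon$. MFCQ at $y\in\mathcal F(\bar x)$: $\nabla_yg(\bar x,y)\lambda=0$ and $0\le-g(\bar x,y)\perp\lambda\ge0$ imply $\lambda=0$. RS at $y\in\mathcal F(\bar x)$: there are $\kappa,\delta>0$ with $\mathrm{dist}(y',\mathcal F(x))\le\kappa\sum_{i=1}^q\max\{g_i(x,y'),0\}$ for all $(x,y')$ in the ball of radius $\delta$ about $(\bar x,y)$. CQs. Consider a system $G(p,z)\le0$, $H(p,z)=0$ in the variable $z$ with parameter $p$ ($G,H$ continuously differentiable), with feasible set $Z(p)$, and put $$\mathcal M(\beta,p,z)=\{(a,b):\beta-\nabla_zG(p,z)a-\nabla_zH(p,z)b=0,\ 0\le a\perp-G(p,z)\ge0,\ H(p,z)=0\}.$$ A condition that may hold or fail at points $(p,z)$ with $z\in Z(p)$ is called a stable parametric CQ if, whenever it holds at $\bar z\in Z(\bar p)$: it is locally persistent, i.e. it holds at every $z\in Z(p)$ with $(p,z)$ in some neighborhood of $(\bar p,\bar z)$; (i) whenever $\bar z$ is a local maximizer over $Z(\bar p)$ of a continuously differentiable function $\varphi$, $\mathcal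 M(\nabla\varphi(\bar z),\bar p,\bar z)\neq\emptyset$; (ii) for all sequences $\beta^k\to\bar\beta$, $z^k\to\bar z$, $p^k\to\bar p$ with $\mathcal M(\beta^k,p^k,z^k)\ne\emptyset$ for all $k$, there exist $(a^k,b^k)\in\mathcal M(\beta^k,p^k,z^k)$ converging along a subsequence to some $(\bar a,\bar b)\in\mathcal M(\bar\beta,\bar p,\bar z)$. A stable CQ is the same notion for a system without parameter (all dependence on $p$ omitted). *)

(* Defs.v *)
From mathcomp Require Import all_boot all_order all_algebra.
From mathcomp Require Import all_classical all_reals all_analysis.

Set Implicit Arguments.
Unset Strict Implicit.
Unset Printing Implicit Defensive.

Import Order.TTheory GRing.Theory Num.Theory.
Import numFieldNormedType.Exports.

Local Open Scope classical_set_scope.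
Local Open Scope ring_scope.

(* Vectors are row vectors.  The matrix ['J F z] satisfies
   ['D_v F z = v *m 'J F z] (rows are indexed by the inputs), so it is the
   transposed Jacobian of F.  A product (matrix)(column vector) [A u] of the
   usual notation thus reads [u *m A^T], and [A^T u] reads [u *m A].

   Norms, balls and distances are those of the sup norm; none of the notions
   below depends on the choice of the norm, since the radii and constants they
   involve are existentially quantified, or occur in a little-o. *)

Section vectors.
Context {R : realType}.

Definition dot d (u v : 'rV[R]_d) : R := (u *m v^T) 0 0.

(* 0 <= a _|_ b >= 0 *)
Definition complementary d (a b : 'rV[R]_d) : Prop :=
  [/\ forall i, 0 <= a 0 i, dot a b = 0 & forall i, 0 <= b 0 i].

Definition boundary (T : topologicalType) (A : set T) : set T :=
  closure A `\` interior A.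

End vectors.

Section smoothness.
Context {R : realType}.

Definition grad d (f : 'rV[R]_d -> R) (z : 'rV[R]_d) : 'rV[R]_d :=
  \row_i 'D_(delta_mx 0 i) f z.

Definition C1fun d (f : 'rV[R]_d -> R) : Prop :=
  (forall z, differentiable f z) /\ continuous (grad f).

Definition C1map d e (F : 'rV[R]_d -> 'rV[R]_e) : Prop :=
  (forall z, differentiable F z) /\
  continuous (fun z => 'J F z : 'M[R]_(d, e)).

Definition C2fun d (f : 'rV[R]_d -> R) : Prop :=
  C1fun f /\ C1map (grad f).

Definition C2map d e (F : 'rV[R]_d -> 'rV[R]_e) : Prop :=
  forall i, C2fun (fun z => F z 0 i).

End smoothness.

Section normal_cones.
Context {R : realType} {d : nat}.
Implicit Types (X : set 'rV[R]_d).

Definition frechet_normal_cone X (x0 : 'rV[R]_d) : set 'rV[R]_d :=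
  [set xi | forall eps : R, 0 < eps ->
     \forall x \near x0, X x -> dot xi (x - x0) <= eps * `|x - x0|].

Definition limiting_normal_cone X (x0 : 'rV[R]_d) : set 'rV[R]_d :=
  [set xi | exists x_ xi_ : nat -> 'rV[R]_d,
     [/\ forall k, X (x_ k),
         x_ @ \oo --> x0,
         forall k, frechet_normal_cone X (x_ k) (xi_ k) &
         xi_ @ \oo --> xi]].

End normal_cones.

(* The system G z <= 0, H z = 0. *)
Section systems.
Context {R : realType} {d r s : nat}.
Variables (G : 'rV[R]_d -> 'rV[R]_r) (H : 'rV[R]_d -> 'rV[R]_s).

Definition feasible : set 'rV[R]_d :=
  [set z | (forall i, G z 0 i <= 0) /\ H z = 0].

Definition multipliers (beta z : 'rV[R]_d) : set ('rV[R]_r * 'rV[R]_s) :=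
  [set ab | [/\ beta - ab.1 *m ('J G z)^T - ab.2 *m ('J H z)^T = 0,
                complementary ab.1 (- G z) & H z = 0]].

Definition local_maximizer (phi : 'rV[R]_d -> R) (Z : set 'rV[R]_d) z0 : Prop :=
  Z z0 /\ \forall z \near z0, Z z -> phi z <= phi z0.

End systems.

Section constraint_qualifications.
Context {R : realType} {c d r s : nat}.

(* A condition CQ on the points of a fixed system is stable when it is locally
   persistent, yields multipliers at local maximizers, and makes multipliers
   stable under convergence. *)
Definition stable_parametric_CQ
    (G : 'rV[R]_c -> 'rV[R]_d -> 'rV[R]_r)
    (H : 'rV[R]_c -> 'rV[R]_d -> 'rV[R]_s)
    (CQ : 'rV[R]_c -> 'rV[R]_d -> Prop) : Prop :=
  let Z p := feasible (G p) (H p) in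
  let M beta p z := multipliers (G p) (H p) beta z in
  forall pb zb, Z pb zb -> CQ pb zb ->
  [/\ \forall pz \near (pb, zb), Z pz.1 pz.2 -> CQ pz.1 pz.2,
      forall phi, C1fun phi -> local_maximizer phi (Z pb) zb ->
        M (grad phi zb) pb zb !=set0 &
      forall (beta_ z_ : nat -> 'rV[R]_d) (p_ : nat -> 'rV[R]_c) betab,
        beta_ @ \oo --> betab -> z_ @ \oo --> zb -> p_ @ \oo --> pb ->
        (forall k, M (beta_ k) (p_ k) (z_ k) !=set0) ->
        exists (a_ : nat -> 'rV[R]_r) (b_ : nat -> 'rV[R]_s),
          (forall k, M (beta_ k) (p_ k) (z_ k) (a_ k, b_ k)) /\
          exists (sigma : nat -> nat) ab bb,
            [/\ increasing_seq sigma,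
                (a_ \o sigma) @ \oo --> ab,
                (b_ \o sigma) @ \oo --> bb &
                M betab pb zb (ab, bb)]].

Definition stable_CQ
    (G : 'rV[R]_d -> 'rV[R]_r) (H : 'rV[R]_d -> 'rV[R]_s)
    (CQ : 'rV[R]_d -> Prop) : Prop :=
  let Z := feasible G H in
  let M beta z := multipliers G H beta z in
  forall zb, Z zb -> CQ zb ->
  [/\ \forall z \near zb, Z z -> CQ z,
      forall phi, C1fun phi -> local_maximizer phi Z zb ->
        M (grad phi zb) zb !=set0 &
      forall (beta_ z_ : nat -> 'rV[R]_d) betab,
        beta_ @ \oo --> betab -> z_ @ \oo --> zb ->
        (forall k, M (beta_ k) (z_ k) !=set0) ->
        exists (a_ : nat -> 'rV[R]_r) (b_ : nat -> 'rV[R]_s),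
          (forall k, M (beta_ k) (z_ k) (a_ k, b_ k)) /\
          exists (sigma : nat -> nat) ab bb,
            [/\ increasing_seq sigma,
                (a_ \o sigma) @ \oo --> ab,
                (b_ \o sigma) @ \oo --> bb &
                M betab zb (ab, bb)]].

End constraint_qualifications.

Section minimax.
Context {R : realType} {n m q : nat}.
Variables (f : 'rV[R]_(n + m) -> R) (g : 'rV[R]_(n + m) -> 'rV[R]_q).
Implicit Types (x : 'rV[R]_n) (y : 'rV[R]_m) (lam : 'rV[R]_q).

Definition lower_feasible x : set 'rV[R]_m :=
  [set y | forall i, g (row_mx x y) 0 i <= 0].

Definition value x : \bar R :=
  ereal_sup [set (f (row_mx x y))%:E | y in lower_feasible x].

Definition solutions x : set 'rV[R]_m :=
  [set y | lower_feasible x y /\ (f (row_mx x y))%:E = value x].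

Definition lagrangian x y lam : R :=
  f (row_mx x y) - dot (g (row_mx x y)) lam.

Definition grad_x_L x y lam : 'rV[R]_n := grad (fun x' => lagrangian x' y lam) x.
Definition grad_y_L x y lam : 'rV[R]_m := grad (fun y' => lagrangian x y' lam) y.

Definition hess_xy_L x y lam : 'M[R]_(n, m) := 'J (fun x' => grad_y_L x' y lam) x.
Definition hess_yy_L x y lam : 'M[R]_(m, m) := 'J (fun y' => grad_y_L x y' lam) y.

Definition grad_y_g x y : 'M[R]_(m, q) := 'J (fun y' => g (row_mx x y')) y.

Definition KKT_multipliers x y : set 'rV[R]_q :=
  [set lam | grad_y_L x y lam = 0 /\ complementary (- g (row_mx x y)) lam].

Definition restricted_sup_compact (xb : 'rV[R]_n) : Prop :=
  value xb \is a fin_num /\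
  exists (eps delta : R) (Omega : set 'rV[R]_m),
    [/\ 0 < eps, 0 < delta, compact Omega &
        forall x, `|x - xb| < delta -> (value xb - eps%:E < value x)%E ->
          solutions x `&` Omega !=set0].

Definition MFCQ (xb : 'rV[R]_n) y : Prop :=
  forall lam, lam *m (grad_y_g xb y)^T = 0 ->
    complementary (- g (row_mx xb y)) lam -> lam = 0.

(* [edist_inf set0 y = +oo], so the distance to an empty set is infinite. *)
Definition robinson_stable (xb : 'rV[R]_n) y : Prop :=
  exists kappa delta : R, [/\ 0 < kappa, 0 < delta &
    forall x y', ball (row_mx xb y) delta (row_mx x y') ->
      (edist_inf (lower_feasible x) y' <=
       (kappa * \sum_(i < q) Num.max (g (row_mx x y') 0 i) 0)%:E)%E].

Definition triple x y lam : 'rV[R]_(n + m + q) := row_mx (row_mx x y) lam.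

(* The system grad_y_L x y lam = 0, lam >= 0 in the variable (x, y, lam). *)
Definition star_ineq (z : 'rV[R]_(n + m + q)) : 'rV[R]_q := - rsubmx z.
Definition star_eq (z : 'rV[R]_(n + m + q)) : 'rV[R]_m :=
  grad_y_L (lsubmx (lsubmx z)) (rsubmx (lsubmx z)) (rsubmx z).

(* "A stable CQ holds at these points": some condition on the points of the
   system is a stable CQ and holds at all of them. *)
Definition star_stable_CQ_holds (xb : 'rV[R]_n) : Prop :=
  exists2 CQ : 'rV[R]_(n + m + q) -> Prop,
    stable_CQ star_ineq star_eq CQ &
    forall y lam, solutions xb y -> KKT_multipliers xb y lam ->
      CQ (triple xb y lam).

(* There is no equality constraint: H takes its values in R^0. *)
Definition lower_stable_CQ_holds (xb : 'rV[R]_n) : Prop :=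
  exists2 CQ : 'rV[R]_n -> 'rV[R]_m -> Prop,
    stable_parametric_CQ (fun x y => g (row_mx x y)) (fun _ _ => 0 : 'rV[R]_0)
      CQ &
    forall y, solutions xb y -> CQ xb y.

End minimax.

(* Main.v *)
Require Import Defs.
From mathcomp Require Import all_boot all_order all_algebra.
From mathcomp Require Import all_classical all_reals all_analysis.
From mathcomp Require Import ring lra.
Set Implicit Arguments.
Unset Strict Implicit.
Unset Printing Implicit Defensive.
Import Order.TTheory GRing.Theory Num.Theory.
Import numFieldNormedType.Exports.
Local Open Scope classical_set_scope.
Local Open Scope ring_scope.

(** Wolfe duality replaces the minimax problem by the single-level problem of
    minimizing the Lagrangian L(x,y,lam) over x in X and over the triples with
    grad_y L = 0 and lam >= 0.  For x in X the function L(x,.,lam) is concave, so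
    a triple of the system has L(x,y,lam) >= V(x)  ([wolfe_weak_duality]); at
    zb = (xb,yb,lamb), where yb is a solution and lamb a multiplier, this bound
    is attained.  Since xb minimizes V locally, zb is a local solution of the
    single-level problem.  Multipliers lamb come from [fritz_john] under MFCQ,
    and from the multiplier property of the stable parametric CQ otherwise.

    The conclusion is the list of KKT conditions of the single-level problem: u
    is the multiplier of the equation grad_y L = 0, and the component along lam
    says that -(u *m grad_y_g) - g is the multiplier of lam >= 0.  These
    conditions have to be derived although the qualification bears on the system
    alone and not on its intersection with X.  So the two are decoupled: a
    triple z = (x',y,lam) ranges over the system, a point x ranges over X, and
    k |x' - x|^2 + |z - zb|^2 is added to L(z).  At a minimizer, 2k (x' - x) is a
    Frechet normal to X at x, and the stable CQ gives multipliers of the system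
    at z ([decoupled_minimizers]).  If the normals 2k (x' - x) stay bounded,
    they cluster, and the closedness property of the stable CQ yields
    multipliers at zb ([stationarity_under_stable_CQ]).

    The normals are bounded because L is calm: L(z) >= L(zb) - C |x' - x| for z in
    the system and x in X close to zb and xb ([lagrangian_calm]).  The point x'
    may lie outside X, where concavity is not available; but (x,y,lam) differs
    from z by x - x' only, so that grad_y L has norm O(|x' - x|) there, and the
    duality inequality at x in X, tested with a maximizer y' in the compact set
    of the restricted sup-compactness, loses only O(|x' - x|). *)

(** * Scalar product and sup norm *)

Lemma dotE {R : realType} d (u v : 'rV[R]_d) : dot u v = \sum_i u 0 i * v 0 i.
Proof. by rewrite /dot mxE; apply: eq_bigr => i _; rewrite mxE. Qed.

Lemma dotC {R : realType} d (u v : 'rV[R]_d) : dot u v = dot v u.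
Proof. by rewrite !dotE; apply: eq_bigr => i _; rewrite mulrC. Qed.

Lemma dotDl {R : realType} d (u v w : 'rV[R]_d) : dot (u + v) w = dot u w + dot v w.
Proof. by rewrite /dot mulmxDl mxE. Qed.

Lemma dotNl {R : realType} d (u v : 'rV[R]_d) : dot (- u) v = - dot u v.
Proof. by rewrite /dot mulNmx mxE. Qed.

Lemma dotBl {R : realType} d (u v w : 'rV[R]_d) : dot (u - v) w = dot u w - dot v w.
Proof. by rewrite dotDl dotNl. Qed.

Lemma dotZl {R : realType} d a (u v : 'rV[R]_d) : dot (a *: u) v = a * dot u v.
Proof. by rewrite /dot -scalemxAl mxE. Qed.

Lemma dot0l {R : realType} d (u : 'rV[R]_d) : dot 0 u = 0.
Proof. by rewrite /dot mul0mx mxE. Qed.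

Lemma dotDr {R : realType} d (u v w : 'rV[R]_d) : dot w (u + v) = dot w u + dot w v.
Proof. by rewrite !(dotC w) dotDl. Qed.

Lemma dotNr {R : realType} d (u v : 'rV[R]_d) : dot u (- v) = - dot u v.
Proof. by rewrite !(dotC u) dotNl. Qed.

Lemma dotBr {R : realType} d (u v w : 'rV[R]_d) : dot w (u - v) = dot w u - dot w v.
Proof. by rewrite dotDr dotNr. Qed.

Lemma dotZr {R : realType} d a (u v : 'rV[R]_d) : dot u (a *: v) = a * dot u v.
Proof. by rewrite !(dotC u) dotZl. Qed.

Lemma dot_delta {R : realType} d (u : 'rV[R]_d) i : dot u (delta_mx 0 i) = u 0 i.
Proof.
rewrite dotE (bigD1 i)//= big1 ?addr0 ?mxE ?eqxx ?mulr1// => j ji.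
by rewrite mxE (negbTE ji) mulr0.
Qed.

(** Identities between gradients and Jacobians are proved below by pairing
    both sides with an arbitrary direction. *)
Lemma dot_eq {R : realType} d (u v : 'rV[R]_d) :
  (forall w, dot u w = dot v w) -> u = v.
Proof. by move=> uv; apply/rowP => i; rewrite -!dot_delta. Qed.

Lemma dot_mulmx_tr {R : realType} d e (b : 'rV[R]_e) (A : 'M[R]_(d, e)) v :
  dot (b *m A^T) v = dot b (v *m A).
Proof. by rewrite /dot trmx_mul mulmxA. Qed.

Lemma dot_ge0 {R : realType} d (u : 'rV[R]_d) : 0 <= dot u u.
Proof. by rewrite dotE sumr_ge0// => i _; rewrite -expr2 sqr_ge0. Qed.

Lemma dot_sqrB {R : realType} d (a b : 'rV[R]_d) :
  dot (a - b) (a - b) = dot a a - 2 * dot a b + dot b b.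
Proof. by rewrite dotBl !dotBr (dotC b a); ring. Qed.

Lemma rV_norm_coord {R : realType} d (u : 'rV[R]_d) i : `|u 0 i| <= `|u|.
Proof. by rewrite [leRHS]mx_normrE; exact: (le_bigmax _ _ (0, i)). Qed.

Lemma rV_norm_le {R : realType} d (u : 'rV[R]_d) e :
  0 <= e -> (forall i, `|u 0 i| <= e) -> `|u| <= e.
Proof.
move=> e0 ue; rewrite [leLHS]mx_normrE; apply: bigmax_le => // -[i j] _ /=.
by rewrite ord1.
Qed.

Lemma sqr_norm_le_dot {R : realType} d (u : 'rV[R]_d) : `|u| ^+ 2 <= dot u u.
Proof.
rewrite -[leRHS](sqr_sqrtr (dot_ge0 u)) lerXn2r ?nnegrE ?sqrtr_ge0//.
apply: rV_norm_le; first exact: sqrtr_ge0.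
move=> i; rewrite -sqrtr_sqr ler_sqrt ?dot_ge0//.
rewrite dotE (bigD1 i)//= expr2 lerDl sumr_ge0// => j _.
by rewrite -expr2 sqr_ge0.
Qed.

Lemma dot_norm_le {R : realType} d (u v : 'rV[R]_d) :
  `|dot u v| <= d%:R * (`|u| * `|v|).
Proof.
rewrite dotE (le_trans (ler_norm_sum _ _ _))//.
rewrite (le_trans (ler_sum _ (G := fun=> `|u| * `|v|) _))//.
  by move=> i _; rewrite normrM ler_pM ?rV_norm_coord.
by rewrite sumr_const card_ord mulr_natl.
Qed.

Lemma norm_row_mx_le {R : realType} d e (u : 'rV[R]_d) (v : 'rV[R]_e) (r : R) :
  0 <= r -> `|u| <= r -> `|v| <= r -> `|row_mx u v| <= r.
Proof.
move=> r0 ur vr; apply: rV_norm_le => // i; rewrite mxE.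
by case: splitP => j _; exact: le_trans (rV_norm_coord _ _) _.
Qed.

Lemma norm_lsubmx_le {R : realType} d e (u : 'rV[R]_(d + e)) : `|lsubmx u| <= `|u|.
Proof. by apply: rV_norm_le => // i; rewrite mxE rV_norm_coord. Qed.

Lemma norm_rsubmx_le {R : realType} d e (u : 'rV[R]_(d + e)) : `|rsubmx u| <= `|u|.
Proof. by apply: rV_norm_le => // i; rewrite mxE rV_norm_coord. Qed.

Lemma norm_mulmxr_le {R : realType} d e (P : 'M[R]_(d, e)) (v : 'rV[R]_d) :
  `|v *m P| <= d%:R * `|P| * `|v|.
Proof.
apply: rV_norm_le => [|i]; first by rewrite !mulr_ge0.
rewrite mxE (le_trans (ler_norm_sum _ _ _))//.
rewrite (le_trans (ler_sum _ (G := fun=> `|P| * `|v|) _))//.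
  move=> j _; rewrite normrM mulrC ler_pM ?rV_norm_coord//.
  by rewrite [leRHS]mx_normrE; exact: (le_bigmax _ _ (j, i)).
by rewrite sumr_const card_ord -mulrA mulr_natl.
Qed.

Lemma norm_triple_x {R : realType} n m q (x : 'rV[R]_n) :
  `|triple x (0 : 'rV[R]_m) (0 : 'rV[R]_q)| <= `|x|.
Proof. by rewrite !norm_row_mx_le ?normr0. Qed.

Lemma lsubmx_mulmx {R : realType} d e (z : 'rV[R]_(d + e)) :
  lsubmx z = z *m col_mx 1%:M 0.
Proof. by rewrite -{2}[z]hsubmxK mul_row_col mulmx1 mulmx0 addr0. Qed.

(** * Continuity and convergence of row vectors *)

(** Neighborhood filters of matrices unfold to products over the entries;
    explicit radii are easier to combine. *)
Lemma nbhs_norm {R : realType} d (z : 'rV[R]_d) (P : 'rV[R]_d -> Prop) :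
  (\forall w \near z, P w) <->
  exists2 e : R, 0 < e & forall w, `|w - z| < e -> P w.
Proof.
split=> [/nbhs_ballP[e /= e0 eP]|[e e0 eP]].
  by exists e => // w wz; apply: eP; rewrite -ball_normE /= distrC.
by apply/nbhs_ballP; exists e => //= w; rewrite -ball_normE /= distrC => /eP.
Qed.

Lemma near_forall {T : topologicalType} (I : finType) (P : I -> T -> Prop) (x : T) :
  (forall i, \forall z \near x, P i z) -> \forall z \near x, forall i, P i z.
Proof. exact: filter_forall. Qed.

(** The rules for sums, products and scalings are restated over an abstract
    domain [T]: for [T] a space of matrices, unification would otherwise unfold
    the neighborhood filter and lose its filter structure. *)
Lemma continuous_addf {R : realType} (T : topologicalType) (F G : T -> R) x :
  continuous_at x F -> continuous_at x G -> continuous_at x (fun z => F z + G z).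
Proof. exact: continuousD. Qed.

Lemma continuous_mulf {R : realType} (T : topologicalType) (F G : T -> R) x :
  continuous_at x F -> continuous_at x G -> continuous_at x (fun z => F z * G z).
Proof. exact: continuousM. Qed.

Lemma continuous_subv {R : realType} (T : topologicalType) (V : normedModType R)
    (F G : T -> V) x :
  continuous_at x F -> continuous_at x G -> continuous_at x (fun z => F z - G z).
Proof. exact: continuousB. Qed.

Lemma continuous_scalev {R : realType} (T : topologicalType) (V : normedModType R)
    (F : T -> V) (c : R) x :
  continuous_at x F -> continuous_at x (fun z => c *: F z).
Proof. exact: continuousZl_tmp. Qed.

Lemma continuous_compose {S T U : topologicalType} (F : S -> T) (G : T -> U) x :
  continuous_at x F -> continuous_at (F x) G -> continuous_at x (fun z => G (F z)).
Proof. exact: continuous_comp. Qed.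

Lemma continuous_max0 {R : realType} {T : topologicalType} (F : T -> R) x :
  continuous_at x F -> continuous_at x (fun z => Num.max (F z) 0).
Proof.
by move=> cF; apply: continuous_max => //; exact: cst_continuous.
Qed.

Lemma continuous_dist {R : realType} (V : normedModType R) (z : V) :
  continuous (fun w => `|w - z|).
Proof. by move=> w; apply: cvg_norm; apply: cvgB => //; exact: cvg_cst. Qed.

Lemma continuous_lt_persists {R : realType} {T : topologicalType} (F : T -> R)
    (x : T) c :
  continuous_at x F -> \forall z \near x, F x < c -> F z < c.
Proof.
move=> cF; have [Fx|Fx] := ltP (F x) c; last exact: nearW.
by apply: filterS (cvgr_lt _ cF _ Fx).
Qed.

Lemma norm_near_bounded {R : realType} (T : topologicalType) (V : normedModType R)
    (F : T -> V) x : continuous_at x F -> \forall z \near x, `|F z| <= `|F x| + 1.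
Proof.
move=> /cvgrPdist_le /(_ 1 ltr01); apply: filterS => z; rewrite distrC => Fz.
by have := ler_normD (F z - F x) (F x); rewrite subrK; lra.
Qed.

Lemma continuous_rV {R : realType} (T : topologicalType) d (F : T -> 'rV[R]_d) x :
  (forall i, continuous_at x (fun z => F z 0 i)) -> continuous_at x F.
Proof.
move=> cF; apply/cvgrPdist_le => e e0.
have : \forall z \near x, forall i, `|F x 0 i - F z 0 i| <= e.
  by apply: filter_forall => i; move/cvgrPdist_le : (cF i); exact.
apply: filterS => z ze; apply: rV_norm_le (ltW e0) _ => i.
by rewrite !mxE.
Qed.

Lemma continuous_at_sum {R : realType} {T : topologicalType} (I : Type) (r : seq I)
  (F : I -> T -> R) x :
  (forall i, continuous_at x (F i)) ->
  continuous_at x (fun z => \sum_(i <- r) F i z).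
Proof.
move=> cF; elim: r => [|i r IH].
  rewrite (_ : (fun _ => _) = cst 0); first exact: cst_continuous.
  by apply/funext => z; rewrite big_nil.
rewrite (_ : (fun _ => _) = (fun z => F i z + \sum_(j <- r) F j z)).
  by apply: continuous_addf; [exact: cF|exact: IH].
by apply/funext => z; rewrite big_cons.
Qed.

Lemma continuous_dot {R : realType} (T : topologicalType) d
    (F G : T -> 'rV[R]_d) x :
  continuous_at x F -> continuous_at x G ->
  continuous_at x (fun z => dot (F z) (G z)).
Proof.
move=> cF cG; under eq_fun do rewrite dotE.
apply: continuous_at_sum => i; apply: continuous_mulf.
  exact: (continuous_comp cF (@coord_continuous _ _ _ 0 i _)).
exact: (continuous_comp cG (@coord_continuous _ _ _ 0 i _)).
Qed.

Lemma continuous_mulmxr {R : realType} d e (P : 'M[R]_(d, e)) :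
  continuous (fun z : 'rV[R]_d => z *m P).
Proof.
move=> z; apply: continuous_rV => i; under eq_fun do rewrite mxE.
apply: continuous_at_sum => j; apply: continuous_mulf.
  exact: coord_continuous.
exact: cst_continuous.
Qed.

Lemma continuous_mulmx {R : realType} (T : topologicalType) d e
    (P : 'M[R]_(d, e)) (F : T -> 'rV[R]_d) x :
  continuous_at x F -> continuous_at x (fun z => F z *m P).
Proof.
by move=> cF; exact: (continuous_compose cF (@continuous_mulmxr _ _ _ P _)).
Qed.

Lemma continuous_at_cvg_seq {S T : topologicalType} (F : S -> T) (u : nat -> S) l :
  continuous_at l F -> u @ \oo --> l -> (fun k => F (u k)) @ \oo --> F l.
Proof. by move=> cF ul; exact: continuous_cvg. Qed.

Lemma cvg_coord {R : realType} d (u : nat -> 'rV[R]_d) (l : 'rV[R]_d) i :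
  u @ \oo --> l -> (fun k => u k 0 i) @ \oo --> l 0 i.
Proof.
move=> ul; apply: (@continuous_at_cvg_seq _ _ (fun v : 'rV[R]_d => v 0 i) _ _ _ ul).
exact: coord_continuous.
Qed.

Lemma cvg_seq_sum {R : realType} (I : finType) (u : I -> nat -> R) l :
  (forall i, u i @ \oo --> l i) -> (fun k => \sum_i u i k) @ \oo --> \sum_i l i.
Proof.
move=> ul; elim: (index_enum I) => [|i r IH].
  rewrite big_nil (_ : (fun k => _) = cst 0); first exact: cvg_cst.
  by apply/funext => k; rewrite big_nil.
rewrite big_cons (_ : (fun k => _) = (fun k => u i k + \sum_(j <- r) u j k)).
  exact: cvgD.
by apply/funext => k; rewrite big_cons.
Qed.

Lemma cvg_of_harmonic_bound {R : realType} d (u : nat -> 'rV[R]_d) l :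
  (forall k, `|u k - l| < k.+1%:R^-1) -> u @ \oo --> l.
Proof.
move=> ul; apply/cvgrPdist_lt => e e0.
have := near_infty_natSinv_lt (PosNum e0); apply: filterS => k /= ke.
by rewrite distrC (lt_trans (ul k)).
Qed.

(** * Differential calculus *)

(** The difference quotients of [fun u => h (A u)] at [a] along [v] are those of
    [h] at [A a] along [w]: no differentiability is involved, and partial
    derivatives are thereby directional derivatives in the product space. *)
Lemma derive_comp_affine {R : realType} (U V W : normedModType R)
    (h : V -> W) (A : U -> V) (a v : U) (w : V) :
  (forall t : R, A (t *: v + a) = t *: w + A a) ->
  'D_v (fun u => h (A u)) a = 'D_w h (A a).
Proof.
by move=> Aaff; rewrite /derive; under eq_fun do rewrite /= Aaff.
Qed.

Lemma differentiable_rV {R : realType} (U : normedModType R) d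
    (F : U -> 'rV[R]_d) a :
  (forall i, differentiable (fun u => F u 0 i) a) -> differentiable F a.
Proof.
move=> dF.
rewrite (_ : F = \sum_(i < d) (fun u => F u 0 i *: (delta_mx 0 i : 'rV[R]_d))).
  by apply: differentiable_sum => i; exact: differentiableZl.
by apply/funext => u; rewrite fct_sumE; exact: row_sum_delta.
Qed.

Lemma differentiable_mulmxr {R : realType} d e (P : 'M[R]_(d, e)) z :
  differentiable (fun z : 'rV[R]_d => z *m P) z.
Proof.
exact/(@linear_differentiable R 'rV[R]_d 'rV[R]_e (mulmxr P))/continuous_mulmxr.
Qed.

Lemma differentiable_affine {R : realType} d e (P : 'M[R]_(d, e)) c z :
  differentiable (fun z : 'rV[R]_d => z *m P + c) z.
Proof.
by apply: differentiableD; [exact: differentiable_mulmxr|exact: differentiable_cst].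
Qed.

Lemma differentiable_coord_fun {R : realType} (U : normedModType R) d
    (F : U -> 'rV[R]_d) z i :
  differentiable F z -> differentiable (fun z => F z 0 i) z.
Proof.
move=> dF.
exact: (differentiable_comp dF (@differentiable_coord _ _ _ _ 0 i)).
Qed.

Lemma derive_grad {R : realType} d (h : 'rV[R]_d -> R) z v :
  differentiable h z -> 'D_v h z = dot (grad h z) v.
Proof.
move=> dh; rewrite deriveE// {1}[v]row_sum_delta linear_sum dotE.
by apply: eq_bigr => i _; rewrite linearZ /grad mxE deriveE// mulrC.
Qed.

Lemma derive_coord {R : realType} d e (F : 'rV[R]_d -> 'rV[R]_e) z v i :
  differentiable F z -> (v *m 'J F z) 0 i = 'D_v (fun z => F z 0 i) z.
Proof.
move=> dF; rewrite -deriveEjacobian// derive_mx ?mxE//.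
exact: diff_derivable.
Qed.

Lemma jacobian_comp_affine {R : realType} c d e (F : 'rV[R]_d -> 'rV[R]_e)
    (A : 'rV[R]_c -> 'rV[R]_d) P a x (v : 'rV[R]_c) :
  (forall x, A x = x *m P + a) -> differentiable F (A x) ->
  v *m 'J (fun x => F (A x)) x = (v *m P) *m 'J F (A x).
Proof.
move=> AE dF; have dA : differentiable A x.
  rewrite (_ : A = fun x => x *m P + a); last exact/funext.
  exact: differentiable_affine.
rewrite -(deriveEjacobian _ (differentiable_comp dA dF)) -(deriveEjacobian _ dF).
apply: derive_comp_affine => t.
by rewrite !AE mulmxDl -scalemxAl addrA.
Qed.

Lemma derive_proj {R : realType} d (z v : 'rV[R]_d) i :
  'D_v (fun z : 'rV[R]_d => z 0 i) z = v 0 i.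
Proof.
rewrite -(@derive_coord _ _ _ id)// -deriveEjacobian// derive_id.
by [].
Qed.

Lemma derive_mulmxr {R : realType} d e (P : 'M[R]_(d, e)) z v i :
  'D_v (fun z : 'rV[R]_d => (z *m P) 0 i) z = (v *m P) 0 i.
Proof.
rewrite -(derive_proj (z *m P)).
apply: (@derive_comp_affine _ _ _ _ (fun y : 'rV[R]_e => y 0 i) (mulmx^~ P)).
by move=> t; rewrite mulmxDl -scalemxAl.
Qed.

(** * Continuously differentiable functions *)

Lemma C1fun_derive_continuous {R : realType} d (h : 'rV[R]_d -> R) v :
  C1fun h -> continuous (fun z => 'D_v h z).
Proof.
move=> [dh ch]; under eq_fun do rewrite derive_grad//.
by move=> z; apply: continuous_dot; [exact: ch|exact: cst_continuous].
Qed.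

Lemma C1fun_continuous {R : realType} d (h : 'rV[R]_d -> R) :
  C1fun h -> continuous h.
Proof. by move=> [dh _] z; exact: differentiable_continuous. Qed.

(** Directional derivatives obey sum and product rules directly, so closure
    properties of [C1fun] are checked on them rather than on gradients. *)
Lemma C1fun_of_derive {R : realType} d (h : 'rV[R]_d -> R) :
  (forall z, differentiable h z) ->
  (forall v, continuous (fun z => 'D_v h z)) -> C1fun h.
Proof.
move=> dh ch; split=> // z; apply: continuous_rV => i.
rewrite /grad; under eq_fun do rewrite mxE.
exact: ch.
Qed.

Lemma C1funD {R : realType} d (h k : 'rV[R]_d -> R) :
  C1fun h -> C1fun k -> C1fun (fun z => h z + k z).
Proof.
move=> Ch Ck; have [[dh _] [dk _]] := (Ch, Ck).
apply: C1fun_of_derive => [z|v z]; first exact: differentiableD.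
have -> : 'D_v (fun z => h z + k z) = (fun z => 'D_v h z + 'D_v k z).
  by apply/funext => y; apply: deriveD; exact: diff_derivable.
by apply: continuous_addf; exact: C1fun_derive_continuous.
Qed.

Lemma C1funM {R : realType} d (h k : 'rV[R]_d -> R) :
  C1fun h -> C1fun k -> C1fun (fun z => h z * k z).
Proof.
move=> Ch Ck; have [[dh _] [dk _]] := (Ch, Ck).
apply: C1fun_of_derive => [z|v z]; first exact: differentiableM.
have -> : 'D_v (fun z => h z * k z) = (fun z => h z * 'D_v k z + k z * 'D_v h z).
  by apply/funext => y; apply: deriveM; exact: diff_derivable.
have [ch ck] := (C1fun_continuous Ch, C1fun_continuous Ck).
have [cDh cDk] := (C1fun_derive_continuous (v := v) Ch,
                   C1fun_derive_continuous (v := v) Ck).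
exact: (continuous_addf (continuous_mulf (ch z) (cDk z))
                        (continuous_mulf (ck z) (cDh z))).
Qed.

Lemma C1fun_cst {R : realType} d (c : R) : C1fun (fun _ : 'rV[R]_d => c).
Proof.
apply: C1fun_of_derive => [z|v]; first exact: differentiable_cst.
under eq_fun do rewrite derive_cst.
by move=> z; exact: cst_continuous.
Qed.

Lemma C1funZ {R : realType} d c (h : 'rV[R]_d -> R) :
  C1fun h -> C1fun (fun z => c * h z).
Proof. by move=> Ch; exact: (C1funM (@C1fun_cst _ _ c) Ch). Qed.

Lemma C1funB {R : realType} d (h k : 'rV[R]_d -> R) :
  C1fun h -> C1fun k -> C1fun (fun z => h z - k z).
Proof.
move=> Ch Ck; have := C1funD Ch (C1funZ (-1) Ck).
by under eq_fun do rewrite mulN1r.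
Qed.

Lemma C1fun_sum {R : realType} d (I : Type) (r : seq I)
    (h : I -> 'rV[R]_d -> R) :
  (forall i, C1fun (h i)) -> C1fun (fun z => \sum_(i <- r) h i z).
Proof.
move=> Ch; elim: r => [|i r IH].
  by under eq_fun do rewrite big_nil; exact: C1fun_cst.
by under eq_fun do rewrite big_cons; exact: (C1funD (Ch i) IH).
Qed.

Lemma C1fun_affine {R : realType} d e (P : 'M[R]_(d, e)) c
    (h : 'rV[R]_e -> R) : C1fun h -> C1fun (fun z => h (z *m P + c)).
Proof.
move=> Ch; have [dh _] := Ch; apply: C1fun_of_derive => [z|v].
  exact: (differentiable_comp (differentiable_affine _ _ _) (dh _)).
have -> : 'D_v (fun z => h (z *m P + c)) =
          (fun z => 'D_(v *m P) h (z *m P + c)).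
  apply/funext => z.
  apply: (@derive_comp_affine _ _ _ _ h (fun z => z *m P + c)) => t.
  by rewrite mulmxDl -scalemxAl addrA.
move=> z; have /differentiable_continuous cA := differentiable_affine P c z.
exact: (@continuous_comp _ _ _ _ ('D_(v *m P) h) z cA
  (@C1fun_derive_continuous _ _ _ _ Ch _)).
Qed.

Lemma C1fun_coord {R : realType} d i : C1fun (fun z : 'rV[R]_d => z 0 i).
Proof.
have dc z : differentiable (fun z : 'rV[R]_d => z 0 i) z.
  exact: differentiable_coord.
apply: C1fun_of_derive => // v.
have -> : 'D_v (fun z : 'rV[R]_d => z 0 i) = cst (v 0 i).
  apply/funext => z; rewrite -derive_coord ?deriveEjacobian//.
  by rewrite -[_ *m _]deriveEjacobian// derive_id.
by move=> z; exact: cst_continuous.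
Qed.

Lemma C1fun_mulmxr {R : realType} d e (P : 'M[R]_(d, e)) i :
  C1fun (fun z => (z *m P) 0 i).
Proof.
by have := C1fun_affine P 0 (C1fun_coord i); under eq_fun do rewrite addr0.
Qed.

Lemma C1fun_lsubmx {R : realType} d e (h : 'rV[R]_d -> R) :
  C1fun h -> C1fun (fun z : 'rV[R]_(d + e) => h (lsubmx z)).
Proof.
move=> Ch; have := C1fun_affine (col_mx 1%:M 0 : 'M[R]_(d + e, d)) 0 Ch.
by under eq_fun do rewrite addr0 -lsubmx_mulmx.
Qed.

Lemma C1map_coord {R : realType} d e (F : 'rV[R]_d -> 'rV[R]_e) i :
  C1map F -> C1fun (fun z => F z 0 i).
Proof.
move=> [dF cF]; apply: C1fun_of_derive => [z|v].
  exact: differentiable_coord_fun.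
have -> : 'D_v (fun z => F z 0 i) = (fun z => (v *m 'J F z) 0 i).
  by apply/funext => z; rewrite derive_coord.
under eq_fun do rewrite mxE; move=> z.
apply: continuous_at_sum => j; apply: continuous_mulf; first exact: cst_continuous.
exact: (@continuous_comp _ _ _ _ (fun M : 'M[R]_(d, e) => M j i) _ (cF z)
  (@coord_continuous _ _ _ _ _ _)).
Qed.

Lemma C2fun_derive {R : realType} d (h : 'rV[R]_d -> R) v :
  C2fun h -> C1fun (fun z => 'D_v h z).
Proof.
move=> [[dh _] Ch]; under eq_fun do rewrite derive_grad// dotE.
apply: C1fun_sum => i; apply: C1funM; last exact: C1fun_cst.
exact: C1map_coord.
Qed.

Lemma C1fun_sqr_dist {R : realType} d e (u : 'rV[R]_d -> 'rV[R]_e) c :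
  (forall i, C1fun (fun z => u z 0 i)) ->
  C1fun (fun z => dot (u z - c) (u z - c)).
Proof.
move=> Cu; under eq_fun do rewrite dotE.
apply: C1fun_sum => i; under eq_fun do rewrite !mxE.
by apply: C1funM; apply: C1funB => //; exact: C1fun_cst.
Qed.

(** Used both for the distance to a point and for the quadratic penalty of
    inequality constraints. *)
Lemma derive_sqr_dist {R : realType} d e (u : 'rV[R]_d -> 'rV[R]_e) c z v :
  (forall i, differentiable (fun z => u z 0 i) z) ->
  'D_v (fun z => dot (u z - c) (u z - c)) z =
  2 * \sum_i (u z - c) 0 i * 'D_v (fun z => u z 0 i) z.
Proof.
move=> du; pose w i := (fun z => u z 0 i - c 0 i) : 'rV[R]_d -> R.
have dw i : derivable (w i) z v.
  by apply: derivableB; [exact: diff_derivable|exact: derivable_cst].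
rewrite (_ : (fun z => _) = \sum_i (w i * w i)); last first.
  apply/funext => y; rewrite dotE fct_sumE.
  by apply: eq_bigr => i _; rewrite !mxE.
rewrite derive_sum => [|i]; last exact: derivableM.
rewrite mulr_sumr; apply: eq_bigr => i _.
rewrite deriveM// /w deriveB ?derive_cst ?subr0; last 2 first.
- exact: diff_derivable.
- exact: derivable_cst.
by rewrite !mxE /= mulr2n mulrDl mul1r.
Qed.

Lemma derive_sqr_norm_sub {R : realType} d (y z v : 'rV[R]_d) :
  'D_v (fun z => dot (z - y) (z - y)) z = 2 * dot (z - y) v.
Proof.
rewrite [LHS](@derive_sqr_dist _ _ _ id) => [|i]; last exact: (C1fun_coord _).1.
by rewrite dotE; congr (_ * _); apply: eq_bigr => i _; rewrite derive_proj.
Qed.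

(** Mean value theorem along the segment joining the two points, on a ball
    where the gradient is bounded. *)
Lemma C1fun_locally_lipschitz {R : realType} d (h : 'rV[R]_d -> R) z0 :
  C1fun h -> exists C e : R, [/\ 0 <= C, 0 < e & forall a b,
    `|a - z0| < e -> `|b - z0| < e -> `|h a - h b| <= C * `|a - b|].
Proof.
move=> Ch; have [dh cg] := Ch.
have /nbhs_norm[e e0 ge] := norm_near_bounded (cg z0).
exists (d%:R * (`|grad h z0| + 1)), e; split=> //.
move=> a b az bz.
pose p (t : R) := t *: (a - b) + b.
have pz t : 0 <= t -> t <= 1 -> `|p t - z0| < e.
  move=> t0 t1; rewrite (_ : p t - z0 = t *: (a - z0) + (1 - t) *: (b - z0)).
    rewrite (le_lt_trans (ler_normD _ _))// !normrZ (ger0_norm t0).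
    rewrite ger0_norm ?subr_ge0//.
    have Me : Num.max `|a - z0| `|b - z0| < e by rewrite gt_max az.
    apply: le_lt_trans Me; set M := Num.max _ _.
    have aM : `|a - z0| <= M by rewrite le_max lexx.
    have bM : `|b - z0| <= M by rewrite le_max lexx orbT.
    by nra.
  by rewrite /p; apply/rowP => i; rewrite !mxE; ring.
have dp t : is_derive t (1 : R) (h \o p) ('D_(a - b) h (p t)).
  have hp : differentiable (h \o p) t.
    by apply: differentiable_comp.
  apply: DeriveDef; first exact: diff_derivable.
  apply: (@derive_comp_affine R R 'rV[R]_d R h p t 1 (a - b)) => s.
  by rewrite /p scalerDl scaler1 addrA.
have cp : {within `[0, 1], continuous (h \o p)}.
  apply: continuous_subspaceT => t; apply: differentiable_continuous.
  by apply/derivable1_diffP; exact: (@ex_derive _ _ _ _ _ _ _ (dp t)).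
have [c] := MVT_segment ler01 (fun t _ => dp t) cp.
rewrite in_itv /= => /andP[c0 c1].
rewrite /p scale1r subrK scale0r add0r subr0 mulr1 => ->.
rewrite derive_grad// (le_trans (dot_norm_le _ _))// -mulrA ler_wpM2l//.
by rewrite ler_wpM2r// ge// pz.
Qed.

Lemma C1coords_locally_lipschitz {R : realType} d e (F : 'rV[R]_d -> 'rV[R]_e) z0 :
  (forall j, C1fun (fun z => F z 0 j)) ->
  exists C r : R, [/\ 0 <= C, 0 < r & forall a b,
    `|a - z0| < r -> `|b - z0| < r -> `|F a - F b| <= C * `|a - b|].
Proof.
move=> CF.
have /choice[Cr CrP] j : exists Cr : R * R, [/\ 0 <= Cr.1, 0 < Cr.2 & forall a b,
    `|a - z0| < Cr.2 -> `|b - z0| < Cr.2 ->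
    `|F a 0 j - F b 0 j| <= Cr.1 * `|a - b|].
  by have [C [r ?]] := C1fun_locally_lipschitz z0 (CF j); exists (C, r).
have C0 : 0 <= \sum_j (Cr j).1 by apply: sumr_ge0 => j _; have [] := CrP j.
exists (\sum_j (Cr j).1), (\big[Num.min/1]_j (Cr j).2); split=> //.
  by apply: lt_bigmin => // j _; have [] := CrP j.
move=> a b ar br; apply: rV_norm_le => [|j]; first by rewrite mulr_ge0.
have [Cj0 _ lip] := CrP j; rewrite !mxE.
have ler : \big[Num.min/1]_j (Cr j).2 <= (Cr j).2 by exact: bigmin_le_cond.
rewrite (le_trans (lip _ _ (lt_le_trans ar ler) (lt_le_trans br ler)))//.
rewrite ler_wpM2r// (bigD1 j)//= lerDl sumr_ge0// => i _.
by have [] := CrP i.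
Qed.

(** * First-order conditions *)

Lemma derive_right_ge {R : realType} d (h : 'rV[R]_d -> R) z v c :
  differentiable h z ->
  (\forall t \near (0 : R)^'+, c <= t^-1 * (h (t *: v + z) - h z)) ->
  c <= 'D_v h z.
Proof.
move=> dh near_c; have dv : derivable h z v by exact: diff_derivable.
rewrite /derive cvg_at_rightE; last exact: dv.
apply: limr_ge; last exact: near_c.
apply/cvg_ex; exists ('D_v h z); apply: cvg_trans dv.
move=> A /nbhs_ballP[e e0 eA]; apply/nbhs_ballP; exists e => // t te t0.
by apply: eA => //; rewrite gt_eqF.
Qed.

Lemma local_min_derive0 {R : realType} d (h : 'rV[R]_d -> R) z v :
  differentiable h z -> (\forall w \near z, h z <= h w) -> 'D_v h z = 0.
Proof.
move=> dh /nbhs_norm[e e0 hmin].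
suff D_ge0 u : 0 <= 'D_u h z.
  apply/eqP; rewrite eq_le D_ge0 andbT -oppr_ge0.
  by rewrite derive_grad// -dotNr -derive_grad.
apply: derive_right_ge => //; near=> t.
have t0 : 0 < t by near: t; exact: nbhs_right_gt.
rewrite mulr_ge0 ?invr_ge0 ?(ltW t0)// subr_ge0 hmin// addrK normrZ gtr0_norm//.
have u1 : 0 < `|u| + 1 by rewrite ltr_wpDl.
have : t < e / (`|u| + 1) by near: t; apply: nbhs_right_lt; exact: divr_gt0.
rewrite ltr_pdivlMr//; apply: le_lt_trans; rewrite ler_wpM2l ?(ltW t0)//.
by rewrite lerDl.
Unshelve. all: by end_near. Qed.

(** Convexity bounds the right difference quotients towards [y'] by
    [h y' - h y]; let the step tend to 0. *)
Lemma convex_gradient_le {R : realType} d (h : 'rV[R]_d -> R) y y' :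
  convex_function (E := 'rV[R]_d) setT h -> differentiable h y ->
  h y + 'D_(y' - y) h y <= h y'.
Proof.
move=> cvx dh.
suff : - (h y' - h y) <= - 'D_(y' - y) h y by lra.
have dhN : differentiable (fun w => - h w) y by exact: differentiableN.
rewrite -(_ : 'D_(y' - y) (fun w => - h w) y = - 'D_(y' - y) h y); last first.
  by rewrite deriveN//; exact: diff_derivable.
apply: derive_right_ge => //; near=> t.
have t0 : 0 < t by near: t; exact: nbhs_right_gt.
have t1 : t < 1 by near: t; exact: nbhs_right_lt.
have := cvx (Itv01 (ltW t0) (ltW t1)) y' y (in_setT _) (in_setT _).
rewrite [X in h X](_ : _ = t *: (y' - y) + y); last first.
  apply/rowP => i; rewrite /conv /= !mxE /unstable.onem /=.
  by rewrite mulrBl mulrBr mul1r -addrA (addrC (- _)).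
rewrite [leRHS](_ : _ = t * h y' + (1 - t) * h y)//.
rewrite ler_pdivlMl//; set a := h (_ + _).
by nra.
Unshelve. all: by end_near. Qed.

(** * Compactness *)

Lemma compact_closed_norm_ball {R : realType} d (z : 'rV[R]_d) r :
  compact [set w | `|w - z| <= r].
Proof.
apply: bounded_closed_compact.
  exists (r + `|z|); split; first by rewrite num_real.
  move=> M rM w /= wr; rewrite -(subrK z w) (le_trans (ler_normD _ _))//.
  by rewrite (le_trans _ (ltW rM))// lerD2r.
rewrite (_ : mkset _ = closed_ball_ Num.norm z r); first exact: closed_closed_ball_.
by apply/seteqP; split=> w /=; rewrite distrC.
Qed.

(** Compactness in the form used for limits of multipliers and normals: if
    [Q e] is met by a point of [K] for every tolerance [e], then some sequence
    meeting [Q] with vanishing tolerances converges.  Otherwise each point of [K]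
    has a neighborhood and a tolerance excluding [Q], and finitely many of them
    cover [K]. *)
Lemma compact_cluster_sequence {R : realType} d (K : set 'rV[R]_d)
    (Q : R -> 'rV[R]_d -> Prop) :
  compact K ->
  (forall e e' a, e <= e' -> Q e a -> Q e' a) ->
  (forall e, 0 < e -> exists2 a, K a & Q e a) ->
  exists (b : 'rV[R]_d) (a_ : nat -> 'rV[R]_d),
    [/\ K b, a_ @ \oo --> b & forall k, K (a_ k) /\ Q k.+1%:R^-1 (a_ k)].
Proof.
move=> cK monoQ exQ.
have [b Kb bQ] : exists2 b, K b &
    forall e, 0 < e -> exists a, [/\ `|a - b| < e, K a & Q e a].
  apply: contrapT => noQ.
  have /(iffLR (compact_near_coveringP K)) coverK := cK.
  have : \forall e \near (0 : R)^'+, K `<=` (fun a => ~ (K a /\ Q e a)).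
    apply: (coverK _ _ (fun e a => ~ (K a /\ Q e a)) _) => b Kb.
    have [e e0 eQ] : exists2 e, 0 < e & forall a,
        ~ [/\ `|a - b| < e, K a & Q e a].
      apply: contrapT => noe; apply: noQ; exists b => // e e0.
      by apply: contrapT => /forallNP eQ; apply: noe; exists e.
    near=> a e'.
    have ab : `|a - b| < e by near: a; apply/nbhs_norm; exists e.
    have ee : e' <= e by near: e'; exact: nbhs_right_le.
    by move=> -[Ka Qa]; apply: (eQ a); split=> //; exact: monoQ Qa.
  move=> nearK.
  have [e [e0 eK]] : exists e, 0 < e /\ K `<=` (fun a => ~ (K a /\ Q e a)).
    near (0 : R)^'+ => e; exists e; split; last by near: e.
    by near: e; exact: nbhs_right_gt.
  by have [a Ka Qa] := exQ e e0; apply: (eK a).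
have /choice[a_ aP] k :
    exists a, [/\ `|a - b| < k.+1%:R^-1, K a & Q k.+1%:R^-1 a].
  by apply: bQ; rewrite invr_gt0.
exists b, a_; split=> // [|k]; last by have [] := aP k.
by apply: cvg_of_harmonic_bound => k; have [] := aP k.
Unshelve. all: by end_near. Qed.

(** The sets where [c < u + k p] increase with [k] and cover [K]. *)
Lemma penalty_on_compact {R : realType} {T : topologicalType} (K : set T)
    (u p : T -> R) c :
  compact K -> continuous u -> continuous p -> (forall z, 0 <= p z) ->
  (forall z, K z -> p z = 0 -> c < u z) ->
  exists k : nat, forall z, K z -> c < u z + k%:R * p z.
Proof.
move=> /compact_near_coveringP coverK cu cp p0 up.
have : \forall k \near \oo, K `<=` (fun z => c < u z + k%:R * p z).
  apply: (coverK _ _ (fun k z => c < u z + k%:R * p z) _) => z Kz.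
  have [pz|pz] := eqVneq (p z) 0.
    near=> z' k; have : c < u z'.
      near: z'; exact: (cvgr_gt _ (cu z) _ (up z Kz pz)).
    by move=> /lt_le_trans; apply; rewrite lerDl mulr_ge0.
  have {}pz : 0 < p z / 2 by rewrite divr_gt0// lt_neqAle eq_sym pz p0.
  near=> z' k.
  have uz' : u z - 1 < u z'.
    by near: z'; apply: (cvgr_gt _ (cu z)); rewrite ltrBlDr ltrDl.
  have pz' : p z / 2 < p z'.
    by near: z'; apply: (cvgr_gt _ (cp z)); lra.
  have kc : (c - u z + 1) / (p z / 2) <= k%:R.
    by near: k; exact: nbhs_infty_ger.
  move: kc; rewrite ler_pdivrMr//= => kc.
  have : k%:R * (p z / 2) <= k%:R * p z' by rewrite ler_wpM2l// ltW.
  by lra.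
by case=> k _ /(_ k (leqnn _)) kK; exists k.
Unshelve. all: by end_near. Qed.

(** * Fritz John conditions *)

(** The square of the positive part is majorized by a parabola that touches it
    at [a], the vertex being [a] if [a < 0] and [0] otherwise.  It replaces the
    differentiation of the positive part. *)
Lemma sqr_pos_part_le {R : realType} (a b : R) :
  Num.max b 0 ^+ 2 <= (b - (a - Num.max a 0)) ^+ 2.
Proof.
have [b0|b0] := ltP b 0; first by rewrite expr0n sqr_ge0.
have [a0|a0] := ltP a 0; last by rewrite subrr subr0.
rewrite subr0 lerXn2r// ?nnegrE//; first by rewrite subr_ge0 (le_trans (ltW a0)).
by rewrite lerBrDr gerDl ltW.
Qed.

(** Minimize [- f] plus [k] times the squared constraint violation plus the
    squared distance to [y] over a small ball.  For large [k] the minimizer is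
    interior, and the multipliers are [2 k] times the violations. *)
Lemma penalized_stationary_point {R : realType} d q (f : 'rV[R]_d -> R)
    (g : 'rV[R]_d -> 'rV[R]_q) y e :
  C1fun f -> (forall i, C1fun (fun z => g z 0 i)) ->
  (forall i, g y 0 i <= 0) ->
  (\forall z \near y, (forall i, g z 0 i <= 0) -> f z <= f y) -> 0 < e ->
  exists c (lam : 'rV[R]_q),
    [/\ `|c - y| < e, forall i, 0 <= lam 0 i,
       forall i, g y 0 i < 0 -> lam 0 i = 0 &
       forall v, 'D_v f c - 2 * dot (c - y) v =
                 \sum_i lam 0 i * 'D_v (fun z => g z 0 i) c].
Proof.
move=> Cf Cg gy ymax e0.
have [[df _] dg] := (Cf, fun i => (Cg i).1).
have near_inactive : \forall z \near y, forall i, g y 0 i < 0 -> g z 0 i < 0.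
  apply: near_forall => i.
  exact: (@continuous_lt_persists R 'rV[R]_d (fun z => g z 0 i) y 0
    (C1fun_continuous (Cg i) (x := y))).
have [/nbhs_norm[e1 e10 e1P] /nbhs_norm[e2 e20 e2P]] := (ymax, near_inactive).
have [r [r0 re re1 re2]] : exists r, [/\ 0 < r, r < e, r < e1 & r < e2].
  exists (Num.min e (Num.min e1 e2) / 2).
  have m0 : 0 < Num.min e (Num.min e1 e2) by rewrite !lt_min e0 e10.
  have : Num.min e (Num.min e1 e2) <= e by rewrite ge_min lexx.
  have : Num.min e (Num.min e1 e2) <= e1 by rewrite !ge_min lexx orbT.
  have : Num.min e (Num.min e1 e2) <= e2 by rewrite !ge_min lexx !orbT.
  by split; lra.
pose p z : R := \sum_i Num.max (g z 0 i) 0 ^+ 2.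
pose w z : R := dot (z - y) (z - y).
pose F (k : nat) z := - f z + k%:R * p z + w z.
have p0 z : 0 <= p z by rewrite sumr_ge0// => i _; rewrite sqr_ge0.
have cp : continuous p.
  move=> z; apply: continuous_at_sum => i; rewrite /= (_ : (fun z => _) =
    (fun z => Num.max (g z 0 i) 0 * Num.max (g z 0 i) 0)); last first.
    by apply/funext => ?; rewrite expr2.
  have cgi := continuous_max0 (C1fun_continuous (Cg i) (x := z)).
  exact: (continuous_mulf cgi cgi).
have Cw : C1fun w by apply: C1fun_sqr_dist => i; exact: C1fun_coord.
have cF k : continuous (F k).
  move=> z; apply: continuous_addf; last exact: C1fun_continuous.
  apply: continuous_addf; last first.
    by apply: continuous_mulf; [exact: cst_continuous|exact: cp].
  by apply: C1fun_continuous; under eq_fun do rewrite -mulN1r; exact: C1funZ.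
have py : p y = 0.
  by apply: big1 => i _; rewrite max_r// expr0n.
have Fy k : F k y = - f y.
  by rewrite /F py mulr0 /w subrr dot0l !addr0.
(* On the sphere a feasible point has [f z <= f y] and is at distance [r] from
   [y], so penalization keeps the minimizer off the sphere. *)
have [k kS] : exists k, forall z, `|z - y| = r -> - f y < F k z.
  have [||z zr pz|k kP] := @penalty_on_compact R _ [set z | `|z - y| = r]
     (fun z => - f z + w z) p (- f y) _ _ cp p0.
  - apply: (@subclosed_compact _ _ _ _ (@compact_closed_norm_ball _ _ y r)).
      rewrite (_ : mkset _ = (fun w => `|w - y|) @^-1` [set r])//.
      by apply: closed_comp => [? _|]; [exact: continuous_dist|exact: closed_eq].
    by move=> z /= ->.
  - move=> z; apply: continuous_addf; last exact: C1fun_continuous.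
    by apply: C1fun_continuous; under eq_fun do rewrite -mulN1r; exact: C1funZ.
  - have gz i : g z 0 i <= 0.
      move/eqP: pz; rewrite psumr_eq0 => [/allP/(_ i (mem_index_enum i))|j _].
        by rewrite /= sqrf_eq0 => /eqP; have [//|] := leP (g z 0 i) 0; lra.
      exact: sqr_ge0.
    have := e1P z _ gz; rewrite zr => /(_ re1).
    have : r ^+ 2 <= w z by rewrite -zr; exact: sqr_norm_le_dot.
    have : 0 < r ^+ 2 by exact: exprn_gt0.
    by lra.
  by exists k => z zr; rewrite /F addrAC; exact: kP.
have [c cK cmin] : exists2 c, `|c - y| <= r &
    forall z, `|z - y| <= r -> F k c <= F k z.
  have [|c] := compact_EVT_min _ (@compact_closed_norm_ball _ _ y r)
      (continuous_subspaceT (cF k)).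
    by exists y; rewrite /= subrr normr0 ltW.
  by rewrite inE => cK cmin; exists c => // z zK; apply: cmin; rewrite inE.
have cr : `|c - y| < r.
  rewrite lt_neqAle cK andbT; apply/eqP => /kS.
  by rewrite -(Fy k) ltNge cmin// subrr normr0 ltW.
pose b := \row_i (g c 0 i - Num.max (g c 0 i) 0).
exists c, (\row_i (2 * k%:R * Num.max (g c 0 i) 0)); split.
- exact: lt_trans re.
- by move=> i; rewrite mxE !mulr_ge0// le_max lexx orbT.
- move=> i gi; rewrite mxE max_r ?mulr0// ltW//.
  exact: e2P (lt_trans cr re2) _ gi.
move=> v.
(* A smooth majorant of [F k] that agrees with it at [c]. *)
pose G z := (- f z + k%:R * dot (g z - b) (g z - b)) + w z.
have Gmin : \forall z \near c, G c <= G z.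
  apply/nbhs_norm; exists (r - `|c - y|); first by rewrite subr_gt0.
  move=> z zc; have zr : `|z - y| <= r.
    rewrite -(subrKA c) (le_trans (ler_normD _ _))//.
    by move: zc; lra.
  have FG z' : F k z' <= G z'.
    rewrite /F /G lerD2r lerD2l ler_wpM2l//.
    rewrite dotE; apply: ler_sum => i _.
    by rewrite !mxE -expr2; exact: sqr_pos_part_le.
  have FGc : G c = F k c.
    rewrite /F /G dotE; congr (_ + _ * _ + _); apply: eq_bigr => i _.
    by rewrite !mxE opprB addrCA subrr addr0 expr2.
  by rewrite FGc (le_trans (cmin z zr)).
have Cgb : C1fun (fun z => dot (g z - b) (g z - b)) by exact: C1fun_sqr_dist.
have dN : derivable (fun z => - f z) c v.
  by apply: derivableN; exact: diff_derivable.
have dgb : derivable (fun z => k%:R * dot (g z - b) (g z - b)) c v.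
  by apply: diff_derivable; have [+ _] := C1funZ k%:R Cgb; exact.
have dw : derivable w c v by apply: diff_derivable; exact: (Cw.1).
have dG : differentiable G c.
  have CN : C1fun (fun z => - f z).
    by under eq_fun do rewrite -mulN1r; exact: C1funZ.
  exact: (C1funD (C1funD CN (C1funZ k%:R Cgb)) Cw).1.
have := local_min_derive0 v dG Gmin.
rewrite /G (deriveD (derivableD dN dgb) dw) (deriveD dN dgb).
rewrite deriveN; last exact: diff_derivable.
rewrite deriveMl; last by apply: diff_derivable; exact: Cgb.1.
rewrite derive_sqr_dist//.
have -> : 'D_v w c = 2 * dot (c - y) v by exact: derive_sqr_norm_sub.
move=> stat.
rewrite [RHS](_ : _ = k%:R *
  (2 * \sum_i (g c - b) 0 i * 'D_v (fun z => g z 0 i) c)).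
  by move: stat; lra.
rewrite !mulr_sumr; apply: eq_bigr => i _; rewrite !mxE; ring.
Qed.

(** Normalize the multipliers of [penalized_stationary_point] so that their sum
    with the coefficient of [f] is 1, which makes them compact, and let the points
    tend to [y].  The coefficient of [f] is kept as [1 - \sum_i mu 0 i]. *)
Lemma fritz_john {R : realType} d q (f : 'rV[R]_d -> R)
    (g : 'rV[R]_d -> 'rV[R]_q) y :
  C1fun f -> (forall i, C1fun (fun z => g z 0 i)) ->
  (forall i, g y 0 i <= 0) ->
  (\forall z \near y, (forall i, g z 0 i <= 0) -> f z <= f y) ->
  exists mu : 'rV[R]_q,
    [/\ forall i, 0 <= mu 0 i, \sum_i mu 0 i <= 1,
       forall i, g y 0 i < 0 -> mu 0 i = 0 &
       forall v, (1 - \sum_i mu 0 i) * 'D_v f y =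
                 \sum_i mu 0 i * 'D_v (fun z => g z 0 i) y].
Proof.
move=> Cf Cg gy ymax.
pose Q e (mu : 'rV[R]_q) := exists c,
  `|c - y| < e /\
    [/\ forall i, 0 <= mu 0 i, \sum_i mu 0 i <= 1,
       forall i, g y 0 i < 0 -> mu 0 i = 0 &
       forall v, (1 - \sum_i mu 0 i) * ('D_v f c - 2 * dot (c - y) v) =
                 \sum_i mu 0 i * 'D_v (fun z => g z 0 i) c].
have exQ e : 0 < e -> exists2 mu, [set mu : 'rV[R]_q | `|mu - 0| <= 1] mu & Q e mu.
  move=> /(penalized_stationary_point Cf Cg gy ymax)[c [lam [ce lam0 lamI stat]]].
  pose s := \sum_i lam 0 i.
  have s0 : 0 <= s by exact: sumr_ge0.
  have s1 : 0 < 1 + s by rewrite ltr_pwDl.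
  pose mu := (1 + s)^-1 *: lam.
  have mu0 i : 0 <= mu 0 i by rewrite mxE mulr_ge0// invr_ge0 ltW.
  have sum_mu : \sum_i mu 0 i = (1 + s)^-1 * s.
    by rewrite mulr_sumr; apply: eq_bigr => i _; rewrite mxE.
  have mu1 : \sum_i mu 0 i <= 1 by rewrite sum_mu ler_pdivrMl// mulr1 lerDr.
  exists mu.
    rewrite /= subr0; apply: rV_norm_le => // i; rewrite ger0_norm//.
    by apply: le_trans mu1; rewrite (bigD1 i)//= lerDl sumr_ge0.
  exists c; split=> //; split=> // [i gi|v]; first by rewrite mxE lamI// mulr0.
  rewrite stat sum_mu (_ : 1 - _ = (1 + s)^-1); last by field; rewrite gt_eqF.
  by rewrite mulr_sumr; apply: eq_bigr => i _; rewrite mxE mulrA.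
have monoQ e e' mu : e <= e' -> Q e mu -> Q e' mu.
  by move=> ee [c [ce ?]]; exists c; split=> //; exact: lt_le_trans ee.
have [mu [mu_ [_ mu_cvg mu_Q]]] :=
  compact_cluster_sequence (@compact_closed_norm_ball _ _ 0 1) monoQ exQ.
have /choice[c_ cP] k := (mu_Q k).2.
have c_cvg : c_ @ \oo --> y.
  by apply: cvg_of_harmonic_bound => k; exact: (cP k).1.
have mu_i i : (fun k => mu_ k 0 i) @ \oo --> mu 0 i by exact: cvg_coord.
have s_cvg : (fun k => \sum_i mu_ k 0 i) @ \oo --> \sum_i mu 0 i.
  exact: (@cvg_seq_sum _ _ (fun i k => mu_ k 0 i)).
exists mu; split.
- move=> i; apply: (cvgr_to_ge (mu_i i)); apply: nearW => k.
  by have [_ [+ _ _ _]] := cP k; exact.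
- by apply: (cvgr_to_le s_cvg); apply: nearW => k; have [_ []] := cP k.
- move=> i gi; apply: (cvg_unique _ (mu_i i)) => //.
  rewrite (_ : (fun k => _) = cst 0); first exact: cvg_cst.
  by apply/funext => k; have [_ [_ _ + _]] := cP k; exact.
move=> v.
have Dcvg (h : 'rV[R]_d -> R) :
    C1fun h -> (fun k => 'D_v h (c_ k)) @ \oo --> 'D_v h y.
  move=> Ch; apply: (@continuous_at_cvg_seq _ _ ('D_v h) _ _ _ c_cvg).
  exact: C1fun_derive_continuous.
have dot_cvg : (fun k => dot (c_ k - y) v) @ \oo --> (0 : R).
  have cdot : continuous_at y (fun c => dot (c - y) v).
    apply: continuous_dot; last exact: cst_continuous.
    by apply: continuous_subv; [exact: cvg_id|exact: cst_continuous].
  have := continuous_at_cvg_seq cdot c_cvg; rewrite subrr dot0l; exact.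
have lhs : (fun k =>
      (1 - \sum_i mu_ k 0 i) * ('D_v f (c_ k) - 2 * dot (c_ k - y) v))
    @ \oo --> (1 - \sum_i mu 0 i) * ('D_v f y - 2 * 0).
  apply: cvgM; apply: cvgB => //; [exact: cvg_cst|exact: Dcvg|].
  by apply: cvgM => //; exact: cvg_cst.
have rhs : (fun k => \sum_i mu_ k 0 i * 'D_v (fun z => g z 0 i) (c_ k))
    @ \oo --> \sum_i mu 0 i * 'D_v (fun z => g z 0 i) y.
  apply: (@cvg_seq_sum _ _ (fun i k => mu_ k 0 i * 'D_v (fun z => g z 0 i) (c_ k))).
  by move=> i; exact: (cvgM (mu_i i) (Dcvg _ (Cg i))).
rewrite mulr0 subr0 in lhs; apply: (cvg_unique _ lhs) => //.
rewrite (_ : (fun k => _) =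
  (fun k => \sum_i mu_ k 0 i * 'D_v (fun z => g z 0 i) (c_ k)))//.
by apply/funext => k; have [_ []] := cP k.
Qed.

(** * Stationarity on a system intersected with an abstract set *)

(** A quadratic error is negligible with respect to [eps * `|x' - x|]. *)
Lemma frechet_normal_of_proximal {R : realType} n (X : set 'rV[R]_n)
    (x eta : 'rV[R]_n) k :
  0 <= k ->
  (\forall x' \near x, X x' -> dot eta (x' - x) <= k * dot (x' - x) (x' - x)) ->
  frechet_normal_cone X x eta.
Proof.
move=> k0 /nbhs_norm[r r0 rP] eps eps0; apply/nbhs_norm.
pose b := k * n%:R + 1.
have b0 : 0 < b by rewrite ltr_wpDl// mulr_ge0.
exists (Num.min r (eps / b)); first by rewrite lt_min r0 divr_gt0.
move=> x' ; rewrite lt_min => /andP[xr xb] Xx'.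
rewrite (le_trans (rP _ xr Xx'))//.
rewrite (le_trans (ler_wpM2l k0 (le_trans (ler_norm _) (dot_norm_le _ _))))//.
rewrite !mulrA ler_wpM2r//.
move: xb; rewrite ltr_pdivlMr// => xb; apply: le_trans (ltW xb).
by rewrite mulrC ler_wpM2l// /b lerDl.
Qed.

(** [z] ranges over [S], [x] over [X], and the constraint [x = z *m P] is
    penalized.  Calmness of [h] in [`|z *m P - x|] dominates the quadratic
    penalty, whence [k * `|z *m P - x| <= C] at minimizers: the normal
    [eta = 2 k (z *m P - x)] stays bounded while the minimizers tend to [zb].
    Minimality in [x] makes [eta] a proximal normal, minimality in [z] makes
    [z] a local maximizer of the function [phi] over [S]. *)
Lemma decoupled_minimizers {R : realType} d n (h : 'rV[R]_d -> R)
    (P : 'M[R]_(d, n)) (S : set 'rV[R]_d) (X : set 'rV[R]_n) zb C e0 :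
  C1fun h -> closed S -> closed X -> S zb -> X (zb *m P) -> 0 <= C -> 0 < e0 ->
  (forall z x, S z -> X x -> `|z - zb| < e0 -> `|x - zb *m P| < e0 ->
     h zb - C * `|z *m P - x| <= h z) ->
  forall e, 0 < e -> exists z x eta,
    [/\ S z, `|z - zb| < e & exists2 phi, C1fun phi /\ local_maximizer phi S z &
         forall v, 'D_v phi z =
           - ('D_v h z + dot eta (v *m P) + 2 * dot (z - zb) v)] /\
    [/\ X x, `|x - zb *m P| < e, frechet_normal_cone X x eta & `|eta| <= 2 * C].
Proof.
move=> Ch cS cX Szb Xxb C0 e00 calm e e1.
set xb := zb *m P in Xxb calm *.
pose r := Num.min e e0 / 2.
have m0 : 0 < Num.min e e0 by rewrite lt_min e1.
have r0 : 0 < r by exact: divr_gt0.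
have re : r < e.
  have : Num.min e e0 <= e by rewrite ge_min lexx.
  by rewrite /r; lra.
have re0 : r < e0.
  have : Num.min e e0 <= e0 by rewrite ge_min lexx orbT.
  by rewrite /r; lra.
pose M := d%:R * `|P|.
have M0 : 0 <= M by rewrite mulr_ge0.
pose del := r / (2 * (M + 1)).
have del0 : 0 < del by rewrite divr_gt0// mulr_gt0// ltr_wpDl.
(* The estimates below give [`|z *m P - x| <= C / k] and
   [`|z - zb| ^+ 2 <= C ^+ 2 / k]; [k] makes these smaller than [r / 2] and
   [del ^+ 2], and [del] leaves room for the norm of [P]. *)
pose k := 1 + C ^+ 2 / del ^+ 2 + 2 * C / r.
have Cdel0 : 0 <= C ^+ 2 / del ^+ 2 by rewrite divr_ge0// sqr_ge0.
have Cr0 : 0 <= 2 * C / r by rewrite divr_ge0// ?mulr_ge0// ltW.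
have k0 : 0 < k by rewrite /k; lra.
have kdel : C ^+ 2 < k * del ^+ 2.
  rewrite /k !mulrDl mul1r divfK ?expf_neq0 ?gt_eqF//.
  have : 0 <= 2 * C / r * del ^+ 2 by rewrite mulr_ge0// sqr_ge0.
  have : 0 < del ^+ 2 by exact: exprn_gt0.
  by lra.
have kr : 2 * C < k * r.
  rewrite /k !mulrDl mul1r divfK ?gt_eqF//.
  have : 0 <= C ^+ 2 / del ^+ 2 * r by rewrite mulr_ge0// ltW.
  by lra.
pose Phi (w : 'rV[R]_d * 'rV[R]_n) : R :=
  h w.1 + k * dot (w.1 *m P - w.2) (w.1 *m P - w.2)
  + dot (w.1 - zb) (w.1 - zb).
have cPhi : continuous Phi.
  have c1 : continuous (fun w : 'rV[R]_d * 'rV[R]_n => w.1).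
    by move=> w; exact: cvg_fst.
  have c2 : continuous (fun w : 'rV[R]_d * 'rV[R]_n => w.2).
    by move=> w; exact: cvg_snd.
  have c3 w : continuous_at w (fun w : 'rV[R]_d * 'rV[R]_n => w.1 *m P - w.2).
    apply: continuous_subv; last exact: c2.
    by apply: continuous_mulmx; exact: c1.
  have c4 w : continuous_at w (fun w : 'rV[R]_d * 'rV[R]_n => w.1 - zb).
    by apply: continuous_subv; [exact: c1|exact: cst_continuous].
  move=> w; apply: continuous_addf; last exact: continuous_dot.
  apply: continuous_addf.
    by apply: continuous_compose; [exact: c1|exact: C1fun_continuous].
  by apply: continuous_mulf; [exact: cst_continuous|exact: continuous_dot].
pose K := ([set z | `|z - zb| <= r] `&` S) `*` ([set x | `|x - xb| <= r] `&` X).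
have cK : compact K.
  apply: compact_setX; apply: compact_closedI => //;
    exact: compact_closed_norm_ball.
have [z [x [[zr Sz] [xr Xx] zxmin]]] : exists z x,
    [/\ `|z - zb| <= r /\ S z, `|x - xb| <= r /\ X x &
     forall z' x', `|z' - zb| <= r -> S z' -> `|x' - xb| <= r -> X x' ->
       Phi (z, x) <= Phi (z', x')].
  have [|[z x]] := compact_EVT_min _ cK (continuous_subspaceT cPhi).
    by exists (zb, xb); split; split=> //=; rewrite subrr normr0 ltW.
  rewrite inE => -[/= zP xP] zxmin; exists z, x; split=> // z' x' *.
  by apply: zxmin; rewrite inE.
pose s := `|z *m P - x|.
have basic : k * s ^+ 2 + `|z - zb| ^+ 2 <= C * s.
  have : Phi (z, x) <= h zb.
    apply: le_trans (zxmin zb xb _ _ _ _) _; rewrite ?subrr ?normr0 ?(ltW r0)//.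
    by rewrite /Phi /= !subrr !dot0l mulr0 !addr0.
  have := calm z x Sz Xx (le_lt_trans zr re0) (le_lt_trans xr re0).
  have := sqr_norm_le_dot (z - zb).
  have := ler_wpM2l (ltW k0) (sqr_norm_le_dot (z *m P - x)).
  by rewrite /Phi /= -/s; lra.
have s0 : 0 <= s by exact: normr_ge0.
have ks : k * s <= C.
  have [->|sn0] := eqVneq s 0; first by rewrite mulr0.
  have sp : 0 < s by rewrite lt_neqAle eq_sym sn0.
  rewrite -(ler_pM2r sp) -mulrA -expr2.
  by have := sqr_ge0 `|z - zb|; lra.
have zdel : `|z - zb| < del.
  rewrite -(ltr_pXn2r (n := 2))// ?nnegrE ?(ltW del0)//.
  rewrite -(ltr_pM2l k0) (le_lt_trans _ kdel)//.
  have : 0 <= k * (k * s ^+ 2) by rewrite !mulr_ge0 ?sqr_ge0// ltW.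
  have := ler_wpM2l (ltW k0) basic.
  have := ler_wpM2l C0 ks.
  by rewrite mulrDr; lra.
have [zri xri] : `|z - zb| < r /\ `|x - xb| < r.
  have delr : del * (2 * (M + 1)) = r.
    by rewrite /del divfK// gt_eqF// mulr_gt0// ltr_wpDl.
  have sr : s < r / 2.
    by rewrite -(ltr_pM2l k0); lra.
  have zPr : `|z *m P - xb| <= M * del.
    rewrite /xb -mulmxBl (le_trans (norm_mulmxr_le _ _))//.
    by rewrite ler_wpM2l// ltW.
  have := ler_distD (z *m P) x xb; rewrite (distrC x (z *m P)) -/s => xtri.
  have : 0 <= M * del by rewrite mulr_ge0// ltW.
  by split; lra.
have CP := C1fun_mulmxr P.
pose w1 z' := dot (z' *m P - x) (z' *m P - x).
pose w2 z' := dot (z' - zb) (z' - zb).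
have C1 : C1fun w1 by exact: C1fun_sqr_dist.
have C2 : C1fun w2 by apply: C1fun_sqr_dist => i; exact: C1fun_coord.
pose phi z' := - (h z' + k * w1 z' + w2 z').
have Chw : C1fun (fun z' => h z' + k * w1 z' + w2 z').
  exact: (C1funD (C1funD Ch (C1funZ k C1)) C2).
exists z, x, ((2 * k) *: (z *m P - x)); split; split.
- by [].
- exact: lt_trans re.
- exists phi.
    split.
      rewrite /phi; under eq_fun do rewrite -mulN1r.
      exact: (C1funZ (-1) Chw).
    split=> //; apply/nbhs_norm; exists (r - `|z - zb|); first by rewrite subr_gt0.
    move=> z' z'z Sz'; have z'r : `|z' - zb| <= r.
      by have := ler_distD z z' zb; lra.
    by rewrite lerN2; exact: (zxmin z' x z'r Sz' xr Xx).
  move=> v.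
  have dh : derivable h z v by apply: diff_derivable; exact: Ch.1.
  have d1 : derivable w1 z v by apply: diff_derivable; exact: C1.1.
  have d2 : derivable w2 z v by apply: diff_derivable; exact: C2.1.
  rewrite /phi deriveN; last by apply: diff_derivable; exact: Chw.1.
  have dk : derivable (fun z' => k * w1 z') z v by exact: derivableZ.
  rewrite (deriveD (derivableD dh dk) d2) (deriveD dh dk) (deriveMl _ d1).
  have -> : 'D_v w2 z = 2 * dot (z - zb) v by exact: derive_sqr_norm_sub.
  rewrite derive_sqr_dist => [|i]; last exact: (CP i).1.
  rewrite dotZl; under eq_bigr do rewrite derive_mulmxr.
  by congr (- (_ + _ + _)); rewrite -dotE mulrCA mulrA.
- by [].
- exact: lt_trans re.
- apply: (@frechet_normal_of_proximal _ _ _ _ _ k (ltW k0)).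
  apply/nbhs_norm; exists (r - `|x - xb|); first by rewrite subr_gt0.
  move=> x' x'x Xx'; have x'r : `|x' - xb| <= r.
    by have := ler_distD x x' xb; lra.
  have := zxmin z x' zr Sz x'r Xx'.
  rewrite /Phi /= lerD2r lerD2l ler_pM2l//.
  rewrite (_ : z *m P - x' = (z *m P - x) - (x' - x)); last first.
    by rewrite opprB addrA subrK.
  rewrite (dot_sqrB (z *m P - x)) dotZl => kle.
  have : 2 * dot (z *m P - x) (x' - x) <= dot (x' - x) (x' - x).
    by lra.
  by move=> /(ler_wpM2l (ltW k0)); lra.
- rewrite normrZ ger0_norm ?mulr_ge0 ?(ltW k0)//.
  by rewrite -/s -mulrA ler_pM2l.
Qed.

(** KKT conditions for minimizing [h z] over the system [G z <= 0, H z = 0]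
    and [z *m P] in [X], when a stable CQ holds for the system alone.  The
    calmness hypothesis takes the place of a qualification linking the system
    to [X]. *)
Lemma stationarity_under_stable_CQ {R : realType} d n r s (h : 'rV[R]_d -> R)
    (G : 'rV[R]_d -> 'rV[R]_r) (H : 'rV[R]_d -> 'rV[R]_s)
    (P : 'M[R]_(d, n)) (X : set 'rV[R]_n) (CQ : 'rV[R]_d -> Prop) zb C e0 :
  C1fun h -> closed (feasible G H) -> closed X -> stable_CQ G H CQ ->
  feasible G H zb -> CQ zb -> X (zb *m P) -> 0 <= C -> 0 < e0 ->
  (forall z x, feasible G H z -> X x -> `|z - zb| < e0 ->
     `|x - zb *m P| < e0 -> h zb - C * `|z *m P - x| <= h z) ->
  exists2 xi, limiting_normal_cone X (zb *m P) xi &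
    multipliers G H (- (grad h zb + xi *m P^T)) zb !=set0.
Proof.
move=> Ch cS cX stab Szb CQzb Xxb C0 e00 calm.
have [/nbhs_norm[e1 e10 CQnear] _ limM] := stab zb Szb CQzb.
pose beta z (xi : 'rV[R]_n) := - (grad h z + xi *m P^T + 2 *: (z - zb)).
pose Q e (xi : 'rV[R]_n) := exists zx : 'rV[R]_d * 'rV[R]_n,
  [/\ `|zx.1 - zb| < e, multipliers G H (beta zx.1 xi) zx.1 !=set0, X zx.2,
     `|zx.2 - zb *m P| < e & frechet_normal_cone X zx.2 xi].
have monoQ e e' xi : e <= e' -> Q e xi -> Q e' xi.
  by move=> ee [zx [? ? ? ? ?]]; exists zx; split=> //; exact: lt_le_trans ee.
have exQ e : 0 < e ->
    exists2 xi, [set xi : 'rV[R]_n | `|xi - 0| <= 2 * C] xi & Q e xi.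
  move=> ep; have m0 : 0 < Num.min e e1 by rewrite lt_min ep.
  have [z [x [xi [[Sz ze [phi [Cphi phimax] Dphi]] [Xx xe nx xiC]]]]] :=
    decoupled_minimizers Ch cS cX Szb Xxb C0 e00 calm m0.
  move: ze xe; rewrite !lt_min => /andP[ze ze1] /andP[xe _].
  exists xi; first by rewrite /= subr0.
  exists (z, x); split=> //=.
  have [_ mult _] := stab z Sz (CQnear z ze1 Sz).
  have := mult phi Cphi phimax; rewrite (_ : grad phi z = beta z xi)//.
  apply: dot_eq => v; rewrite -derive_grad; last exact: Cphi.1.
  rewrite /beta dotNl 2!dotDl dotZl dot_mulmx_tr Dphi.
  by rewrite (derive_grad _ (Ch.1 z)).
have [xi [xi_ [_ xi_cvg xi_Q]]] :=
  compact_cluster_sequence (@compact_closed_norm_ball _ _ 0 (2 * C)) monoQ exQ.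
have /choice[zx_ zxP] k := (xi_Q k).2.
pose z_ k := (zx_ k).1; pose x_ k := (zx_ k).2.
have z_cvg : z_ @ \oo --> zb.
  by apply: cvg_of_harmonic_bound => k; have [] := zxP k.
have x_cvg : x_ @ \oo --> zb *m P.
  by apply: cvg_of_harmonic_bound => k; have [] := zxP k.
have beta_cvg : (fun k => beta (z_ k) (xi_ k)) @ \oo --> - (grad h zb + xi *m P^T).
  rewrite -[grad h zb + _]addr0 -[X in _ + X](scaler0 _ 2) -(subrr zb).
  apply: cvgN; apply: cvgD; first apply: cvgD.
  - exact: (continuous_at_cvg_seq (Ch.2 zb) z_cvg).
  - exact: (continuous_at_cvg_seq (@continuous_mulmxr _ _ _ P^T xi) xi_cvg).
  - have cz : continuous_at zb (fun z => 2 *: (z - zb)).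
      apply: continuous_scalev; apply: continuous_subv; first exact: cvg_id.
      exact: cst_continuous.
    exact: (continuous_at_cvg_seq cz z_cvg).
have [|a_ [b_ [_ [sigma [ab [bb [_ _ _ Mb]]]]]]] := limM _ _ _ beta_cvg z_cvg.
  by move=> k; have [] := zxP k.
exists xi; last by exists (ab, bb).
exists x_, xi_; split=> // k; by have [] := zxP k.
Qed.

(** * Derivatives of the Lagrangian *)

Section lagrangian_calculus.
Context {R : realType} {n m q : nat}.
Variables (f : 'rV[R]_(n + m) -> R) (g : 'rV[R]_(n + m) -> 'rV[R]_q).
Hypotheses (f_C2 : C2fun f) (g_C2 : C2map g).
Implicit Types (x : 'rV[R]_n) (y : 'rV[R]_m) (lam : 'rV[R]_q)
  (z : 'rV[R]_(n + m + q)).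

(** The Lagrangian as a function of the single vector [triple x y lam], the
    variable of the system [star_ineq], [star_eq]. *)
Definition joint_lagrangian z : R :=
  lagrangian f g (lsubmx (lsubmx z)) (rsubmx (lsubmx z)) (rsubmx z).

Local Notation L := joint_lagrangian.
Local Notation H := (star_eq f g).

Lemma joint_lagrangian_triple x y lam : L (triple x y lam) = lagrangian f g x y lam.
Proof. by rewrite /joint_lagrangian /triple !row_mxKl !row_mxKr. Qed.

Lemma star_eq_triple x y lam : H (triple x y lam) = grad_y_L f g x y lam.
Proof. by rewrite /star_eq /triple !row_mxKl !row_mxKr. Qed.

Lemma triple_submx z :
  z = triple (lsubmx (lsubmx z)) (rsubmx (lsubmx z)) (rsubmx z).
Proof. by rewrite /triple !hsubmxK. Qed.

Lemma joint_lagrangianE z :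
  L z = f (lsubmx z) - \sum_i g (lsubmx z) 0 i * z 0 (rshift (n + m) i).
Proof.
rewrite /joint_lagrangian /lagrangian hsubmxK dotE; congr (_ - _).
by apply: eq_bigr => i _; rewrite [in X in _ * X]mxE.
Qed.

Lemma C1_joint_lagrangian : C1fun L.
Proof.
rewrite (_ : L = (fun z =>
  f (lsubmx z) - \sum_i g (lsubmx z) 0 i * z 0 (rshift (n + m) i))).
  apply: C1funB; first exact: C1fun_lsubmx f_C2.1.
  apply: C1fun_sum => i; apply: C1funM; last exact: C1fun_coord.
  exact: C1fun_lsubmx (g_C2 i).1.
by apply/funext => z; exact: joint_lagrangianE.
Qed.

Lemma derive_partial_y (h : 'rV[R]_(n + m) -> R) x y v :
  'D_v (fun y' => h (row_mx x y')) y = 'D_(row_mx 0 v) h (row_mx x y).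
Proof.
apply: derive_comp_affine => t.
by rewrite scale_row_mx scaler0 add_row_mx add0r.
Qed.

Lemma differentiable_partial_y (h : 'rV[R]_(n + m) -> R) x y :
  C1fun h -> differentiable (fun y' => h (row_mx x y')) y.
Proof.
move=> [dh _].
rewrite (_ : (fun y' => _) = (fun y' => h (y' *m row_mx 0 1%:M + row_mx x 0))).
  exact: (differentiable_comp (differentiable_affine _ _ _) (dh _)).
by apply/funext => y'; rewrite mul_mx_row mulmx0 mulmx1 add_row_mx add0r addr0.
Qed.

Lemma C1fun_partial_y (h : 'rV[R]_(n + m) -> R) x :
  C1fun h -> C1fun (fun y' => h (row_mx x y')).
Proof.
move=> Ch; have := C1fun_affine (row_mx 0 1%:M) (row_mx x 0) Ch.
by under eq_fun do rewrite mul_mx_row mulmx0 mulmx1 add_row_mx add0r addr0.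
Qed.

Lemma dot_grad_y_L x y lam v :
  dot (grad_y_L f g x y lam) v = 'D_(row_mx 0 v) f (row_mx x y) -
    \sum_i lam 0 i * 'D_(row_mx 0 v) (fun w => g w 0 i) (row_mx x y).
Proof.
pose h i y' := g (row_mx x y') 0 i * lam 0 i.
have dg i : derivable (fun y' => g (row_mx x y') 0 i) y v.
  exact/diff_derivable/(differentiable_partial_y _ _ (g_C2 i).1).
have df : derivable (fun y' => f (row_mx x y')) y v.
  exact/diff_derivable/(differentiable_partial_y _ _ f_C2.1).
have dh i : derivable (h i) y v.
  exact: (derivableM (dg i) (@derivable_cst _ _ _ (lam 0 i) y v)).
have E : (fun y' => lagrangian f g x y' lam) =
    (fun y' => f (row_mx x y') - (\sum_i h i) y').
  by apply/funext => y'; rewrite /lagrangian dotE fct_sumE.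
rewrite /grad_y_L -derive_grad.
  rewrite E deriveB//; last exact: derivable_sum.
  rewrite derive_partial_y derive_sum//; congr (_ - _); apply: eq_bigr => i _.
  rewrite /h (deriveMr _ (dg i)) mulrC.
  by rewrite (derive_partial_y (fun w => g w 0 i)) mulrC.
rewrite E; apply: differentiableB.
  exact: (differentiable_partial_y _ _ f_C2.1).
apply: differentiable_sum => i; apply: differentiableM => //.
exact: (differentiable_partial_y _ _ (g_C2 i).1).
Qed.

Lemma mulmx_grad_y_g x y v i :
  (v *m grad_y_g g x y) 0 i = 'D_(row_mx 0 v) (fun w => g w 0 i) (row_mx x y).
Proof.
rewrite -derive_partial_y derive_coord//.
apply: differentiable_rV => j.
exact: (differentiable_partial_y _ _ (g_C2 j).1).
Qed.

Lemma grad_y_LE x y lam :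
  grad_y_L f g x y lam =
  grad (fun y' => f (row_mx x y')) y - lam *m (grad_y_g g x y)^T.
Proof.
apply: dot_eq => v; rewrite dot_grad_y_L dotBl dot_mulmx_tr.
rewrite -derive_grad; last exact: (differentiable_partial_y _ _ f_C2.1).
rewrite derive_partial_y dotE; congr (_ - _); apply: eq_bigr => i _.
by rewrite mulmx_grad_y_g.
Qed.

Lemma derive_x_lagrangian x y lam v :
  dot (grad_x_L f g x y lam) v = 'D_(triple v 0 0) L (triple x y lam).
Proof.
have AE (x' : 'rV[R]_n) : triple x' y lam =
   x' *m row_mx (row_mx 1%:M 0) 0 + triple 0 y lam.
  by rewrite /triple !mul_mx_row mulmx1 !mulmx0 !add_row_mx !add0r addr0.
have E : (fun x' => lagrangian f g x' y lam) = (fun x' => L (triple x' y lam)).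
  by apply/funext => x'; rewrite joint_lagrangian_triple.
rewrite /grad_x_L E -derive_grad.
  apply: derive_comp_affine => t.
  by rewrite /triple !scale_row_mx !scaler0 !add_row_mx !add0r.
under eq_fun do rewrite AE.
exact: (differentiable_comp (differentiable_affine _ _ _)
                            (C1_joint_lagrangian.1 _)).
Qed.

Lemma derive_y_lagrangian x y lam v :
  dot (grad_y_L f g x y lam) v = 'D_(triple 0 v 0) L (triple x y lam).
Proof.
have AE (y' : 'rV[R]_m) : triple x y' lam =
   y' *m row_mx (row_mx 0 1%:M) 0 + triple x 0 lam.
  by rewrite /triple !mul_mx_row mulmx1 !mulmx0 !add_row_mx !add0r addr0.
have E : (fun y' => lagrangian f g x y' lam) = (fun y' => L (triple x y' lam)).
  by apply/funext => y'; rewrite joint_lagrangian_triple.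
rewrite /grad_y_L E -derive_grad.
  apply: derive_comp_affine => t.
  by rewrite /triple !scale_row_mx !scaler0 !add_row_mx !add0r.
under eq_fun do rewrite AE.
exact: (differentiable_comp (differentiable_affine _ _ _)
                            (C1_joint_lagrangian.1 _)).
Qed.

Lemma derive_lam_lagrangian x y lam v :
  'D_(triple 0 0 v) L (triple x y lam) = - dot (g (row_mx x y)) v.
Proof.
rewrite -(@derive_comp_affine _ _ _ _ L (fun lam' => triple x y lam') lam v)//.
  under eq_fun do rewrite joint_lagrangian_triple /lagrangian dotC.
  rewrite deriveB; last 2 first.
  - exact: derivable_cst.
  - apply: diff_derivable; apply: (@differentiable_coord_fun _ _ _ (mulmx^~ _)).
    exact: differentiable_mulmxr.
  by rewrite derive_cst sub0r derive_mulmxr -/(dot _ _) dotC.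
by move=> t; rewrite /triple !scale_row_mx !scaler0 !add_row_mx !add0r.
Qed.

(** A component of [star_eq] combines first derivatives of [f] and [g], which
    are continuously differentiable, with the coordinates of [lam]. *)
Lemma C1_star_eq j : C1fun (fun z => H z 0 j).
Proof.
have E : (fun z => H z 0 j) = (fun z =>
    'D_(row_mx 0 (delta_mx 0 j)) f (lsubmx z) -
    \sum_i z 0 (rshift (n + m) i) *
      'D_(row_mx 0 (delta_mx 0 j)) (fun w => g w 0 i) (lsubmx z)).
  apply/funext => z; rewrite -dot_delta dot_grad_y_L hsubmxK; congr (_ - _).
  by apply: eq_bigr => i _; rewrite [in X in X * _]mxE.
rewrite E; apply: C1funB.
  exact: C1fun_lsubmx (C2fun_derive _ f_C2).
apply: C1fun_sum => i; apply: C1funM; first exact: C1fun_coord.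
exact: C1fun_lsubmx (C2fun_derive _ (g_C2 i)).
Qed.

Lemma differentiable_star_eq z : differentiable H z.
Proof. by apply: differentiable_rV => j; exact: (C1_star_eq j).1. Qed.

Lemma jacobian_star_eq_x x y lam v :
  triple v 0 0 *m 'J H (triple x y lam) = v *m hess_xy_L f g x y lam.
Proof.
have AE (x' : 'rV[R]_n) : triple x' y lam =
   x' *m row_mx (row_mx 1%:M 0) 0 + triple 0 y lam.
  by rewrite /triple !mul_mx_row mulmx1 !mulmx0 !add_row_mx !add0r addr0.
rewrite /hess_xy_L; under [in RHS]eq_fun do rewrite -star_eq_triple.
rewrite (jacobian_comp_affine _ AE); last exact: differentiable_star_eq.
by rewrite !mul_mx_row mulmx1 !mulmx0.
Qed.

Lemma jacobian_star_eq_y x y lam v :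
  triple 0 v 0 *m 'J H (triple x y lam) = v *m hess_yy_L f g x y lam.
Proof.
have AE (y' : 'rV[R]_m) : triple x y' lam =
   y' *m row_mx (row_mx 0 1%:M) 0 + triple x 0 lam.
  by rewrite /triple !mul_mx_row mulmx1 !mulmx0 !add_row_mx !add0r addr0.
rewrite /hess_yy_L; under [in RHS]eq_fun do rewrite -star_eq_triple.
rewrite (jacobian_comp_affine _ AE); last exact: differentiable_star_eq.
by rewrite !mul_mx_row mulmx1 !mulmx0.
Qed.

Lemma jacobian_star_eq_lam x y lam v :
  triple 0 0 v *m 'J H (triple x y lam) = - (v *m (grad_y_g g x y)^T).
Proof.
have AE (lam' : 'rV[R]_q) : triple x y lam' =
   lam' *m row_mx 0 1%:M + triple x y 0.
  by rewrite /triple !mul_mx_row mulmx1 !mulmx0 !add_row_mx !add0r addr0.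
rewrite (_ : triple 0 0 v = v *m row_mx 0 1%:M); last first.
  by rewrite mul_mx_row mulmx1 mulmx0 /triple row_mx0.
rewrite -(jacobian_comp_affine _ AE); last exact: differentiable_star_eq.
under [in LHS]eq_fun do rewrite star_eq_triple grad_y_LE addrC -mulmxN.
rewrite (@jacobian_comp_affine _ _ _ _ id _ (- (grad_y_g g x y)^T) _ _ _
  (fun=> erefl))//.
by rewrite -deriveEjacobian// derive_id mulmxN.
Qed.

End lagrangian_calculus.

Lemma star_ineqE {R : realType} n m q :
  @star_ineq R n m q = mulmx^~ (- col_mx 0 1%:M).
Proof.
apply/funext => z.
by rewrite -{2}[z]hsubmxK mulmxN mul_row_col mulmx0 mulmx1 add0r.
Qed.

Lemma jacobian_star_ineq {R : realType} n m q (z v : 'rV[R]_(n + m + q)) :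
  v *m 'J (@star_ineq R n m q) z = - rsubmx v.
Proof.
rewrite -[RHS]/(star_ineq v) star_ineqE.
rewrite (@jacobian_comp_affine _ _ _ _ id _ (- col_mx 0 1%:M) 0)//.
  by rewrite -deriveEjacobian// derive_id.
by move=> x; rewrite addr0.
Qed.

(** * Wolfe duality and lower-level multipliers *)

Section wolfe.
Context {R : realType} {n m q : nat}.
Variables (f : 'rV[R]_(n + m) -> R) (g : 'rV[R]_(n + m) -> 'rV[R]_q).
Hypotheses (f_C2 : C2fun f) (g_C2 : C2map g).
Implicit Types (x : 'rV[R]_n) (y : 'rV[R]_m) (lam : 'rV[R]_q).

(** Gradient inequalities for [f (x,.)] and each [g_i (x,.)], the latter
    weighted by [lam].  The gradient term, which vanishes on the system, is kept:
    [lagrangian_calm] applies the inequality at points near the system. *)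
Lemma wolfe_weak_duality x y y' lam :
  convex_function (E := 'rV[R]_m) setT (fun y => - f (row_mx x y)) ->
  (forall i, convex_function (E := 'rV[R]_m) setT (fun y => g (row_mx x y) 0 i)) ->
  (forall i, 0 <= lam 0 i) -> lower_feasible g x y' ->
  f (row_mx x y') <=
  lagrangian f g x y lam + dot (grad_y_L f g x y lam) (y' - y).
Proof.
move=> fx gx lam0 gy'.
have df := differentiable_partial_y x y f_C2.1.
have fle : f (row_mx x y') <=
    f (row_mx x y) + 'D_(row_mx 0 (y' - y)) f (row_mx x y).
  have := convex_gradient_le (y := y) y' fx.
  rewrite deriveN; last exact: diff_derivable.
  by rewrite derive_partial_y => /(_ (differentiableN df)); lra.
have gle : \sum_i lam 0 i * (g (row_mx x y) 0 i +
    'D_(row_mx 0 (y' - y)) (fun w => g w 0 i) (row_mx x y)) <= 0.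
  apply: sumr_le0 => i _; rewrite mulr_ge0_le0//.
  have dg := differentiable_partial_y x y (g_C2 i).1.
  apply: le_trans (gy' i); have := convex_gradient_le y' (gx i) dg.
  by rewrite (derive_partial_y (fun w => g w 0 i)).
move: gle; rewrite dot_grad_y_L//; under eq_bigr do rewrite mulrDr.
rewrite big_split /= /lagrangian dotC dotE.
by lra.
Qed.

Lemma solutions_max x y y' :
  solutions f g x y -> lower_feasible g x y' -> f (row_mx x y') <= f (row_mx x y).
Proof.
move=> [_ fV] gy'; rewrite -lee_fin fV.
by apply: ereal_sup_ubound; exists y'.
Qed.

(** MFCQ excludes Fritz John multipliers whose coefficient on the objective
    vanishes; divide by this coefficient. *)
Lemma KKT_multipliers_of_MFCQ x y :
  solutions f g x y -> MFCQ g x y -> KKT_multipliers f g x y !=set0.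
Proof.
move=> Sxy mfcq; have gy := Sxy.1.
have [|i|//||mu [mu0 mu1 muI stat]] :=
  @fritz_john _ _ _ (fun y' => f (row_mx x y')) (fun y' => g (row_mx x y')) y.
- exact: C1fun_partial_y f_C2.1.
- exact: (C1fun_partial_y _ (g_C2 i).1).
- by apply/nbhs_norm; exists 1 => // y' _ gy'; exact: (solutions_max Sxy gy').
have compl_mu : complementary (- g (row_mx x y)) mu.
  split=> // [i|]; first by rewrite mxE oppr_ge0.
  rewrite dotE big1// => i _; have := gy i; rewrite le_eqVlt mxE.
  by move=> /orP[/eqP ->|/muI ->]; rewrite ?oppr0 ?mul0r ?mulr0.
have dgE v : dot (mu *m (grad_y_g g x y)^T) v =
    \sum_i mu 0 i * 'D_v (fun y' => g (row_mx x y') 0 i) y.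
  rewrite dot_mulmx_tr dotE; apply: eq_bigr => i _.
  by rewrite mulmx_grad_y_g// (derive_partial_y (fun w => g w 0 i)).
pose t := 1 - \sum_i mu 0 i.
have t0 : t != 0.
  apply/eqP => t0; have mu_eq0 : mu = 0.
    apply: mfcq => //; apply: dot_eq => v.
    by rewrite dgE -stat -/t t0 mul0r dot0l.
  move: t0; rewrite /t big1 => [|i _]; last by rewrite mu_eq0 mxE.
  by rewrite subr0 => /eqP; rewrite oner_eq0.
have tp : 0 <= t^-1 by rewrite invr_ge0 subr_ge0.
exists (t^-1 *: mu); split.
  rewrite grad_y_LE//; apply: dot_eq => v.
  rewrite dot0l dotBl -scalemxAl dotZl dgE -stat -/t mulKf//.
  by rewrite -derive_grad ?subrr//; exact: (differentiable_partial_y _ _ f_C2.1).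
have [g0 gmu _] := compl_mu; split=> //.
  by rewrite dotZr gmu mulr0.
by move=> i; rewrite mxE mulr_ge0.
Qed.

(** A solution maximizes [f (x,.)] over the feasible set, so the multiplier
    property of the qualification applies. *)
Lemma KKT_multipliers_of_lower_CQ x y :
  solutions f g x y -> lower_stable_CQ_holds f g x ->
  KKT_multipliers f g x y !=set0.
Proof.
move=> Sxy [CQ stab /(_ y Sxy) CQxy].
have Zxy : feasible (fun y => g (row_mx x y)) (fun _ => 0 : 'rV[R]_0) y.
  by split=> //; exact: Sxy.1.
have [_ mult _] := stab x y Zxy CQxy.
have [|[lam b] [/= stat [lam0 cmp g0] _]] := mult _ (C1fun_partial_y x f_C2.1).
  split=> //; apply/nbhs_norm; exists 1 => // y' _ [gy' _].
  exact: (solutions_max Sxy gy').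
exists lam; split.
  move: stat; rewrite (thinmx0 b) mul0mx subr0.
  by rewrite grad_y_LE.
by split=> //; rewrite dotC.
Qed.

End wolfe.

(** * Calmness of the Lagrangian *)

Section wolfe_calm.
Context {R : realType} {n m q : nat}.
Variables (f : 'rV[R]_(n + m) -> R) (g : 'rV[R]_(n + m) -> 'rV[R]_q).
Hypotheses (f_C2 : C2fun f) (g_C2 : C2map g).

Local Notation S := (feasible (@star_ineq R n m q) (star_eq f g)).
Local Notation L := (joint_lagrangian f g).

Lemma star_feasibleE z :
  S z <-> (forall i, 0 <= rsubmx z 0 i) /\ star_eq f g z = 0.
Proof.
split=> -[z0 ?]; split=> // i; have := z0 i;
  by rewrite [star_ineq z 0 i]mxE oppr_le0.
Qed.

Lemma closed_star_feasible : closed S.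
Proof.
have -> : S = \bigcap_i ((fun z => star_ineq z 0 i) @^-1` [set a | a <= 0]) `&`
    \bigcap_j ((fun z => star_eq f g z 0 j) @^-1` [set 0]).
  apply/seteqP; split=> z.
    by move=> [zi zj]; split=> [i _|j _] /=; [exact: zi|rewrite zj mxE].
  move=> [zi zj]; split=> [i|]; first exact: (zi i I).
  by apply/rowP => j; rewrite [RHS]mxE; exact: (zj j I).
apply: closedI; apply: closed_bigI => i _; apply: closed_comp;
  rewrite ?closed_le ?closed_eq// => z _.
  by rewrite star_ineqE; apply: C1fun_continuous; exact: C1fun_mulmxr.
exact: (C1fun_continuous (C1_star_eq f_C2 g_C2 i)).
Qed.

(** Compare [z = (x',y,lam)] with [w = (x,y,lam)].  By Lipschitz continuity, [L w]
    exceeds [L z] by at most a multiple of [`|x' - x|], and [star_eq w] is of the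
    same order.  As [x] is in [X], weak duality at [w], tested with a solution
    [y'] in the compact set of the restricted sup-compactness, bounds
    [f (x,y') = V x >= V xb = L zb] by [L w] plus a multiple of [`|x' - x|]. *)
Lemma lagrangian_calm (X : set 'rV[R]_n) xb yb lamb :
  (forall x, X x ->
    convex_function (E := 'rV[R]_m) setT (fun y => - f (row_mx x y))) ->
  (forall x, X x -> forall i,
    convex_function (E := 'rV[R]_m) setT (fun y => g (row_mx x y) 0 i)) ->
  (\forall x \near xb, X x -> (value f g xb <= value f g x)%E) ->
  restricted_sup_compact f g xb ->
  solutions f g xb yb -> KKT_multipliers f g xb yb lamb ->
  let zb := triple xb yb lamb in
  exists C r, [/\ 0 <= C, 0 < r & forall z x, S z -> X x ->
    `|z - zb| < r -> `|x - xb| < r ->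
    L zb - C * `|lsubmx (lsubmx z) - x| <= L z].
Proof.
move=> fX gX /nbhs_norm[r1 r10 locmin] [Vfin [eps [delta [K rsc]]]] Syb lamb_KKT zb.
have [eps0 delta0 cK S_K] := rsc.
have [C1 [r2 [C10 r20 lipL]]] :=
  C1fun_locally_lipschitz zb (C1_joint_lagrangian f_C2 g_C2).
have [C2 [r3 [C20 r30 lipH]]] := C1coords_locally_lipschitz zb (C1_star_eq f_C2 g_C2).
have [B B0 KB] : exists2 B, 0 <= B & forall y, K y -> `|y| <= B.
  have [M [_ MB]] := compact_bounded cK.
  exists (`|M| + 1); first by rewrite addr_ge0.
  by move=> y; apply: MB; rewrite (le_lt_trans (ler_norm _))// ltrDl.
have Lzb : L zb = f (row_mx xb yb).
  rewrite joint_lagrangian_triple /lagrangian.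
  have [_ [_ + _]] := lamb_KKT.
  by rewrite dotNl => /eqP; rewrite oppr_eq0 => /eqP ->; rewrite subr0.
pose D := B + `|yb| + 1.
(* Thirds, because [`|w - zb| <= 2 * `|z - zb| + `|x - xb|] below. *)
pose r := Num.min (Num.min 1 (Num.min r1 delta)) (Num.min (r2 / 3) (r3 / 3)).
exists (C1 + m%:R * (C2 * D)), r; split.
- by rewrite addr_ge0// mulr_ge0// mulr_ge0// /D !addr_ge0.
- by rewrite !lt_min ltr01 r10 delta0 !divr_gt0.
move=> z x /star_feasibleE[lam0 Hz] Xx zr xr.
have [[zr1 xr1 xrd] [zr2 zr3] [xr2 xr3]] :
    [/\ [/\ `|z - zb| < 1, `|x - xb| < r1 & `|x - xb| < delta],
        `|z - zb| < r2 / 3 /\ `|z - zb| < r3 / 3 &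
        `|x - xb| < r2 / 3 /\ `|x - xb| < r3 / 3].
  move: zr xr; rewrite /r !lt_min.
  move=> /andP[/and3P[z1 _ _] /andP[z2 z3]] /andP[/and3P[_ x1 xd] /andP[x2 x3]].
  by [].
set x' := lsubmx (lsubmx z); set y := rsubmx (lsubmx z).
set lam := rsubmx z in lam0 *.
have zE : z = triple x' y lam by exact: triple_submx.
pose w := triple x y lam.
have wz : w - z = triple (x - x') 0 0.
  by rewrite {1}zE /triple opp_row_mx opp_row_mx !add_row_mx !subrr.
have normwz : `|w - z| <= `|x' - x|.
  by rewrite wz distrC norm_triple_x.
have x'xb : `|x' - xb| <= `|z - zb|.
  have -> : x' - xb = lsubmx (lsubmx (z - zb)).
    by rewrite zE /zb /triple !opp_row_mx !add_row_mx !row_mxKl.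
  exact: le_trans (norm_lsubmx_le _) (norm_lsubmx_le _).
have yyb : `|y - yb| <= `|z - zb|.
  have -> : y - yb = rsubmx (lsubmx (z - zb)).
    by rewrite zE /zb /triple !opp_row_mx !add_row_mx row_mxKl row_mxKr.
  exact: le_trans (norm_rsubmx_le _) (norm_lsubmx_le _).
have wzb : `|w - zb| <= `|z - zb| + (`|z - zb| + `|x - xb|).
  have := ler_distD z w zb; have := ler_distD xb x' x; rewrite (distrC xb).
  by lra.
have [y' [[gy' fy'] Oy']] : solutions f g x `&` K !=set0.
  apply: S_K => //; apply: lt_le_trans (locmin x xr1 Xx).
  have [_ <-] := Syb.
  by rewrite -EFinB lte_fin ltrBlDr ltrDl.
have fmin : f (row_mx xb yb) <= f (row_mx x y').
  rewrite -lee_fin fy'; have [_ ->] := Syb; exact: locmin.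
have dual := wolfe_weak_duality f_C2 g_C2 y (fX x Xx) (gX x Xx) lam0 gy'.
have Lw : lagrangian f g x y lam <= L z + C1 * `|x' - x|.
  have zb2 : `|z - zb| < r2 by lra.
  have wb2 : `|w - zb| < r2 by lra.
  have := lipL _ _ wb2 zb2; rewrite joint_lagrangian_triple => Lwz.
  have := le_trans (le_trans (ler_norm _) Lwz) (ler_wpM2l C10 normwz).
  by lra.
have Hw : dot (grad_y_L f g x y lam) (y' - y) <= m%:R * (C2 * D) * `|x' - x|.
  have zb3 : `|z - zb| < r3 by lra.
  have wb3 : `|w - zb| < r3 by lra.
  have := lipH _ _ wb3 zb3; rewrite Hz subr0 star_eq_triple => Hwz.
  rewrite (le_trans (ler_norm _))// (le_trans (dot_norm_le _ _))//.
  rewrite -!mulrA ler_wpM2l// [D * _]mulrC mulrA ler_pM//.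
    exact: le_trans Hwz (ler_wpM2l C20 normwz).
  have := ler_normB y' y; have := KB _ Oy'.
  have := ler_normD (y - yb) yb; rewrite subrK /D.
  by lra.
rewrite Lzb mulrDl.
by lra.
Qed.

End wolfe_calm.

(** * The minimax stationarity conditions *)

Unset Implicit Arguments.

Theorem theorem4p4 (R : realType) (n m q : nat)
    (f : 'rV[R]_(n + m) -> R) (g : 'rV[R]_(n + m) -> 'rV[R]_q)
    (X : set 'rV[R]_n) (xb : 'rV[R]_n)
    (closedX : closed X)
    (f_concave : forall x, X x ->
      convex_function (E := 'rV[R]_m) setT (fun y => - f (row_mx x y)))
    (g_convex : forall x, X x -> forall i,
      convex_function (E := 'rV[R]_m) setT (fun y => g (row_mx x y) 0 i))
    (f_C2 : C2fun f) (g_C2 : C2map g)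
    (xb_bdy : boundary X xb)
    (xb_locmin : X xb /\
      \forall x \near xb, X x -> (value f g xb <= value f g x)%E)
    (xb_rsc : restricted_sup_compact f g xb)
    (conditions :
      ((forall y, solutions f g xb y -> MFCQ g xb y) /\
       star_stable_CQ_holds f g xb)
      \/
      [/\ exists2 y, solutions f g xb y & robinson_stable g xb y,
          lower_stable_CQ_holds f g xb,
          star_stable_CQ_holds f g xb &
          \bigcup_(y in solutions f g xb)
            \bigcup_(lam in KKT_multipliers f g xb y)
              [set u *m (hess_xy_L f g xb y lam)^T | u in
                [set u : 'rV[R]_m |
                  u *m (hess_yy_L f g xb y lam)^T = 0 /\
                  complementary (- (u *m grad_y_g g xb y)) lam]]
          = [set 0]]) :
  exists (yb : 'rV[R]_m) (lamb : 'rV[R]_q) (ub : 'rV[R]_m),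
    solutions f g xb yb /\ KKT_multipliers f g xb yb lamb /\
    (exists2 xi, limiting_normal_cone X xb xi &
       0 = grad_x_L f g xb yb lamb + ub *m (hess_xy_L f g xb yb lamb)^T + xi) /\
    grad_y_L f g xb yb lamb = 0 /\
    ub *m (hess_yy_L f g xb yb lamb)^T = 0 /\
    complementary (- (ub *m grad_y_g g xb yb) - g (row_mx xb yb)) lamb /\
    complementary (- g (row_mx xb yb)) lamb.
Proof.
have [Xxb locmin] := xb_locmin.
have [yb Syb] : solutions f g xb !=set0.
  have [Vfin [eps [delta [K [eps0 delta0 _ SK]]]]] := xb_rsc.
  have [||y [Sy _]] := SK xb; last by exists y.
    by rewrite subrr normr0.
  by rewrite -(fineK Vfin) -EFinB lte_fin ltrBlDr ltrDl.
have [[lamb lamb_KKT] [CQ star_CQ CQ_star]] :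
    KKT_multipliers f g xb yb !=set0 /\ star_stable_CQ_holds f g xb.
  case: conditions => [[mfcq starCQ]|[_ lowerCQ starCQ _]]; split=> //.
    exact: (KKT_multipliers_of_MFCQ f_C2 g_C2 Syb (mfcq _ Syb)).
  exact: (KKT_multipliers_of_lower_CQ f_C2 g_C2 Syb lowerCQ).
have [gradL0 [g0 glam0 lam0]] := lamb_KKT.
pose zb := triple xb yb lamb.
pose P : 'M[R]_(n + m + q, n) := col_mx (col_mx 1%:M 0) 0.
have zP (z : 'rV[R]_(n + m + q)) : z *m P = lsubmx (lsubmx z).
  rewrite /P -{1}[z]hsubmxK mul_row_col mulmx0 addr0.
  exact/esym/lsubmx_mulmx.
have tP x y lam : triple x y lam *m P = x by rewrite zP !row_mxKl.
have Szb : feasible (@star_ineq R n m q) (star_eq f g) zb.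
  by apply/star_feasibleE; rewrite star_eq_triple /zb /triple row_mxKr.
have [C [r [C0 r0 calm]]] :=
  lagrangian_calm f_C2 g_C2 f_concave g_convex locmin xb_rsc Syb lamb_KKT.
have Xzb : X (zb *m P) by rewrite tP.
have calmP z x : feasible (@star_ineq R n m q) (star_eq f g) z -> X x ->
    `|z - zb| < r -> `|x - zb *m P| < r ->
    joint_lagrangian f g zb - C * `|z *m P - x| <= joint_lagrangian f g z.
  by move=> Sz Xx zr; rewrite tP zP => xr; exact: calm.
have [xi nxi [[a u] [/= stat [a0 alam _] _]]] :=
  stationarity_under_stable_CQ (C1_joint_lagrangian f_C2 g_C2)
    (closed_star_feasible f_C2 g_C2) closedX star_CQ Szb
    (CQ_star _ _ Syb lamb_KKT) Xzb C0 r0 calmP.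
rewrite tP in nxi.
have {}stat v : dot (grad (joint_lagrangian f g) zb) v + dot xi (v *m P) =
    dot a (rsubmx v) - dot u (v *m 'J (star_eq f g) zb).
  have := congr1 (fun w => dot w v) stat.
  rewrite dot0l !dotBl dotNl dotDl !dot_mulmx_tr.
  rewrite (_ : v *m 'J _ zb = - rsubmx v); last exact: jacobian_star_ineq.
  by rewrite dotNr; lra.
have DL := derive_grad (_ : 'rV[R]_(n + m + q))
  ((C1_joint_lagrangian f_C2 g_C2).1 zb).
exists yb, lamb, u; split=> //; split=> //; split; last split=> //; last split.
- exists xi => //; apply: dot_eq => v.
  have := stat (triple v 0 0).
  rewrite -DL -derive_x_lagrangian// tP jacobian_star_eq_x// row_mxKr.
  by rewrite dot0l !dotDl dot_mulmx_tr (dotC a) dot0l; lra.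
- apply: dot_eq => v; have := stat (triple 0 v 0).
  rewrite -DL -derive_y_lagrangian// gradL0 tP jacobian_star_eq_y// row_mxKr.
  by rewrite (dotC xi) (dotC a) !dot0l dot_mulmx_tr; lra.
(* The component of stationarity along [lam] identifies the multiplier of
   [lam >= 0]. *)
have aE : a = - (u *m grad_y_g g xb yb) - g (row_mx xb yb).
  apply: dot_eq => v; have := stat (triple 0 0 v).
  rewrite -DL derive_lam_lagrangian// tP jacobian_star_eq_lam// row_mxKr.
  rewrite (dotC xi) dot0l dotNr dotBl dotNl.
  by rewrite (dotC u (_ *m _)) dot_mulmx_tr (dotC v); lra.
have lambE : - star_ineq zb = lamb by rewrite /star_ineq opprK /zb /triple row_mxKr.
rewrite -aE; split=> //; split=> //.
by rewrite -lambE.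
Qed.
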